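(* Let $M\subset\mathbb R^2$ be the Bunimovich stadium, and let $a$ be any continuous function on $\overline M$ that is identically $1$ on the non-rectangular part of $M$. Then there exists $C>0$ such that for every Dirichlet eigenfunction $u$ of the Laplacian on $M$, $$-\Delta u=\lambda u \ \text{ in } M,\qquad u|_{\partial M}=0,$$ we have $$C\int_M |a(x)u(x)|^2\,dx\ \ge\ \int_M |u(x)|^2\,dx .$$
   Context: The Bunimovich stadium $M$ is the convex planar domain obtained from a rectangle $R$ by attaching two half-discs to two opposite sides of $R$ (the diameters of the half-discs being those sides). The non-rectangular part of $M$ is $M\setminus R$, i.e. the union of the two half-discs. *)

(* Defs.v *)
From HB Require Import structures.
From mathcomp Require Import all_boot all_order all_algebra.
From mathcomp Require Import all_classical all_reals all_analysis.
From mathcomp Require Import complex.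
Set Implicit Arguments.
Unset Strict Implicit.
Unset Printing Implicit Defensive.
Import Order.TTheory GRing.Theory Num.Theory.
Import numFieldNormedType.Exports.
Local Open Scope classical_set_scope.
Local Open Scope ring_scope.

(* Coordinates of [x] in the frame with origin [c] and axes [e] and [e] rotated
   by a right angle; the frame is orthonormal as soon as [e] is a unit vector. *)
Definition coord1 (R : realType) (c e x : R * R) : R :=
  (x.1 - c.1) * e.1 + (x.2 - c.2) * e.2.
Definition coord2 (R : realType) (c e x : R * R) : R :=
  (x.2 - c.2) * e.1 - (x.1 - c.1) * e.2.

(* The rectangle with centre [c] and side lengths [2 l] (along [e]) and [2 r].
   Of its boundary we keep the two (open) sides that will carry the half-discs,
   as they are interior to the stadium, and not the two free sides. *)
Definition rectangle (R : realType) (c e : R * R) (l r : R) : set (R * R) :=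
  [set x | `|coord1 c e x| <= l /\ `|coord2 c e x| < r].

(* The open half-disc of radius [r] outside the rectangle whose diameter is the
   side through [c + l e]; replacing [e] by [- e] gives the opposite one. *)
Definition half_disc (R : realType) (c e : R * R) (l r : R) : set (R * R) :=
  [set x | l < coord1 c e x /\
           (coord1 c e x - l) ^+ 2 + coord2 c e x ^+ 2 < r ^+ 2].

Definition stadium (R : realType) (c e : R * R) (l r : R) : set (R * R) :=
  rectangle c e l r `|` (half_disc c e l r `|` half_disc c (- e) l r).

Definition boundary (R : realType) (M : set (R * R)) : set (R * R) :=
  closure M `\` M°.

(* [f] is twice continuously differentiable on the open set [M]: first and
   second order differentiability are in the sense of Frechet. *)
Definition C2_on (R : realType) (M : set (R * R)) (f : R * R -> R) : Prop :=
  forall x, M x ->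
    differentiable f x /\
    forall v : R * R,
      differentiable ('D_v f) x /\
      forall w : R * R, {for x, continuous ('D_w ('D_v f))}.

Definition laplacian (R : realType) (f : R * R -> R) (x : R * R) : R :=
  'D_(1, 0) ('D_(1, 0) f) x + 'D_(0, 1) ('D_(0, 1) f) x.

(* Real and imaginary parts: [R[i]] carries no topology over [R] in the
   libraries, so continuity, smoothness and the Laplacian of complex-valued
   functions are taken componentwise. *)
Definition re_part (R : realType) (f : R * R -> R[i]) (x : R * R) : R :=
  complex.Re (f x).
Definition im_part (R : realType) (f : R * R -> R[i]) (x : R * R) : R :=
  complex.Im (f x).

Definition continuous_onC (R : realType) (A : set (R * R))
    (f : R * R -> R[i]) : Prop :=
  {within A, continuous (re_part f)} /\ {within A, continuous (im_part f)}.

Definition C2_onC (R : realType) (M : set (R * R))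
    (f : R * R -> R[i]) : Prop :=
  C2_on M (re_part f) /\ C2_on M (im_part f).

Definition laplacianC (R : realType) (f : R * R -> R[i]) (x : R * R) : R[i] :=
  Complex (laplacian (re_part f) x) (laplacian (im_part f) x).

(* Only the values of [u] on [closure M] matter. *)
Definition dirichlet_eigenfunction (R : realType) (M : set (R * R))
    (lambda : R) (u : R * R -> R[i]) : Prop :=
  [/\ C2_onC M u,
      continuous_onC (closure M) u,
      forall x, M x -> - laplacianC u x = (real_complex R lambda) * u x,
      forall x, boundary M x -> u x = 0
    & exists2 x, M x & u x != 0].

(* [\int_M |f|^2] for a complex-valued [f]. *)
Definition mass (R : realType) (M : set (R * R)) (f : R * R -> R[i]) : \bar R :=
  (\int[(@lebesgue_measure R \x @lebesgue_measure R)%E]_(x in M)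
     (Normc.normc (f x) ^+ 2)%:E)%E.

(* Main.v *)
Require Import Defs.
From mathcomp Require Import all_boot all_order all_algebra.
From mathcomp Require Import all_classical all_reals all_analysis.
From mathcomp Require Import measurable_realfun.
From mathcomp Require Import complex.
From mathcomp Require Import ring lra.
Import Order.TTheory GRing.Theory Num.Theory.
Import numFieldNormedType.Exports.
Set Implicit Arguments.
Unset Strict Implicit.
Unset Printing Implicit Defensive.
Local Open Scope classical_set_scope.
Local Open Scope ring_scope.

(** Since [a] is continuous and equal to 1 on the half-discs, compactness of the
    two sides that carry them gives [|a| >= 1/2] also on the end strips
    [l - d <= |s| <= l] of the rectangle, [s] being the coordinate along its
    axis ([damping_lower_bound]). So it suffices to bound the mass of [u] in the
    rectangle by its mass in the two end strips, with a constant that does not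
    depend on the eigenvalue ([strip_control]). This is a statement on the
    rectangle alone: it only uses that [u] solves the equation there and vanishes
    on the free sides [|y| = r]. It is proved for the real and the imaginary part
    of [u] separately, in the frame of the rectangle.

    For a real solution [g], let [w(x, s)] be the integral over the cross-section
    of [g(x, y) g(s, y)] ([pairing]) and [F(x) = w(x, x)]. As the second
    derivative in [y] is self-adjoint on functions that vanish at [y = r] and
    [y = - r], the eigenvalue cancels and [w] satisfies the one-dimensional wave
    equation in [(x, s)]. Hence [w(x + h, x - h)] is the sum of a function of [x]
    and a function of [h], that is, [F(x) - w(x + h, x - h)] does not depend on
    [x] ([parallelogram]). As [|w(x + h, x - h)|] is at most the mean of
    [F(x + h)] and [F(x - h)], the value [F(x)] is at most this mean plus an error
    that the values of [F] at any other triple [z - h], [z], [z + h] control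
    ([pairing_submean]); take the triple in an end strip. Thus, for the masses of
    cells of length [h] at most [d / 3], convexity holds up to an error
    controlled by an end strip, and a convex sequence is bounded by its two end
    values ([submean_mass_le]). The constant depends on the number of cells only.

    The solution is [C^2] inside but merely continuous up to the free sides, so
    its derivatives could be unbounded there. It is therefore first mollified
    along the rectangle, in [x] only ([mollify]). This keeps the equation and the
    boundary condition; tangential derivatives of the mollified function are
    integrals of [g] itself, hence bounded up to the free sides, and through the
    equation so is the second normal derivative ([derive_mollify_normal]). That
    is enough for the boundary terms of Green's identity to vanish ([green_itv]),
    and the parallelogram law passes to the limit because it has no derivatives
    in it. *)

(** * Continuity and derivatives of integrals depending on a parameter *)

(** Curried binary functions are used throughout, since partial derivatives are
    derivatives of their slices. *)
Definition continuous2_at (T S U : topologicalType) (f : T -> S -> U) t s :=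
  {for (t, s), continuous (fun z => f z.1 z.2)}.

Lemma continuous2_comp (X T S U : topologicalType) (f : T -> S -> U)
    (p : X -> T) (q : X -> S) x :
  {for x, continuous p} -> {for x, continuous q} ->
  continuous2_at f (p x) (q x) -> {for x, continuous (fun x => f (p x) (q x))}.
Proof.
move=> cp cq cf.
exact: (@continuous_comp _ _ _ (fun x => (p x, q x)) (fun z => f z.1 z.2) x
  (cvg_pair cp cq) cf).
Qed.

Lemma continuous2_slice (T S U : topologicalType) (f : T -> S -> U) t s :
  continuous2_at f t s -> {for s, continuous (f t)}.
Proof.
move=> cf; apply: (continuous2_comp (p := cst t) (q := id)) cf.
  exact: cvg_cst.
exact: cvg_id.
Qed.

Section integrals.
Variable R : realType.
Notation mu := (@lebesgue_measure R).
Implicit Types (a b : R).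

Lemma integrable_continuous_itv a b (f : R -> R) :
  {in `[a, b], continuous f} -> mu.-integrable `[a, b] (EFin \o f).
Proof.
move=> cf; apply: continuous_compact_integrable; first exact: segment_compact.
by apply: continuous_in_subspaceT => x /set_mem; exact: cf.
Qed.

(** The tube lemma: continuity at each point of the slice over [t0] is uniform in
    the compact variable. *)
Lemma near_itv_uniform (T : topologicalType) (f : T -> R -> R) t0 a b (e : R) :
  0 < e -> {in `[a, b], forall y, continuous2_at f t0 y} ->
  \forall t \near t0, {in `[a, b], forall y, `|f t0 y - f t y| < e}.
Proof.
move=> e0 cf.
have /compact_near_coveringP cK := @segment_compact R a b.
apply: (cK T (nbhs t0) (fun t y => `|f t0 y - f t y| < e) _) => y yab.
have cy := cf y yab.
have c1 : {for (t0, y), continuous (fun z : T * R => f t0 z.2)}.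
  apply: (continuous_comp (f := @snd T R) (g := f t0)); first exact: cvg_snd.
  exact: (continuous2_slice cy).
have c2 := cvgB c1 cy; rewrite subrr in c2.
have {}c2 := c2 (nbhs_filter _).
move/cvgrPdist_lt : c2 => /(_ _ e0)[[U V]/= [Ut Vy] UV].
exists (V, U) => //= -[z t]/= [Vz Ut']; have := UV (t, z) (conj Ut' Vz).
by rewrite /= sub0r normrN.
Qed.

Lemma continuous_integral (T : topologicalType) (f : T -> R -> R) t0 a b :
  (\forall t \near t0, {in `[a, b], continuous (f t)}) ->
  {in `[a, b], forall y, continuous2_at f t0 y} ->
  {for t0, continuous (fun t => \int[mu]_(y in `[a, b]) f t y)}.
Proof.
move=> ct cf; apply/cvgrPdist_le => /= e e0.
pose d := e / (1 + `|b - a|).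
have d0 : 0 < d by rewrite divr_gt0// ltr_wpDr.
have ct0 := nbhs_singleton ct.
have near_d := near_itv_uniform d0 cf.
near=> t.
have i0 := integrable_continuous_itv ct0.
have ct1 : {in `[a, b], continuous (f t)} by near: t.
have i1 := integrable_continuous_itv ct1.
have cd : {in `[a, b], continuous (fun y => f t0 y - f t y)}.
  by move=> y yab; apply: cvgB; [exact: ct0|exact: ct1].
rewrite -RintegralB//; apply: le_trans (le_normr_Rintegral _ _) _ => //.
  exact: integrable_continuous_itv.
apply: (@le_trans _ _ (\int[mu]_(y in `[a, b]) d)); last first.
  rewrite Rintegral_cst// /d.
  rewrite [X in fine X](lebesgue_measure_itv `[a, b]) /= lte_fin.
  case: ltP => ab /=; last by rewrite mulr0 ltW.
  rewrite -mulrA ler_piMr ?(ltW e0)// mulrC ler_pdivrMr ?mul1r ?ltr_wpDr//.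
  by rewrite (le_trans (ler_norm _))// lerDr.
apply: le_Rintegral => //.
- apply: integrable_continuous_itv => y yab.
  by apply: cvg_norm; exact: cd.
- by apply: integrable_continuous_itv => y _; exact: cvg_cst.
move=> y yab; apply/ltW.
have : {in `[a, b], forall y, `|f t0 y - f t y| < d} by near: t.
by apply.
Unshelve. all: by end_near. Qed.

(** The differential equations are only known inside the domain, so the
    derivative of the integrand is required on the open interval only. The
    differentiation under the integral sign is dominated by [|f' x0 y| + 1], by
    uniformity in the compact variable. *)
Lemma is_derive_integral (f f' : R -> R -> R) (x0 : R) a b :
  (\forall x \near x0, {in `[a, b], continuous (f x)}) ->
  (\forall x \near x0, {in `]a, b[, forall y,
     is_derive (x : R) (1 : R) (f ^~ y) (f' x y)}) ->
  {in `[a, b], continuous (f' x0)} ->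
  {in `[a, b], forall y, continuous2_at f' x0 y} ->
  is_derive x0 1 (fun x => \int[mu]_(y in `[a, b]) f x y)
    (\int[mu]_(y in `[a, b]) f' x0 y).
Proof.
move=> cf df cf'0 cf'.
have near_1 := near_itv_uniform ltr01 cf'.
have [e/= e0 He] : \forall x \near x0, [/\ {in `[a, b], continuous (f x)},
    {in `]a, b[, forall y, is_derive (x : R) (1 : R) (f ^~ y) (f' x y)} &
    {in `[a, b], forall y, `|f' x0 y - f' x y| < 1}].
  near=> x; split; by near: x.
pose I : set R := [set` `]x0 - e, x0 + e[].
have HI x : I x -> [/\ {in `[a, b], continuous (f x)},
    {in `]a, b[, forall y, is_derive (x : R) (1 : R) (f ^~ y) (f' x y)} &
    {in `[a, b], forall y, `|f' x0 y - f' x y| < 1}].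
  by rewrite /I/= in_itv/= => xe; apply: He => /=; rewrite distrC ltr_distl.
have Ix0 : I x0 by rewrite /I/= in_itv/= ltrBlDr ltrDl e0.
pose G y := `|f' x0 y| + 1.
have oc : [set` `]a, b[] `<=` [set` `[a, b]] by exact: subset_itv_oo_cc.
have intf x : I x -> mu.-integrable `]a, b[ (EFin \o f x).
  move=> /HI[cfx _ _]; apply: integrableS (integrable_continuous_itv cfx) => //.
have derf x y : I x -> `]a, b[%classic y -> derivable (f^~ y) x 1.
  by move=> /HI[_ + _] yab => /(_ _ yab)[].
have G0 y : 0 <= G y by rewrite /G addr_ge0.
have intG : mu.-integrable `]a, b[ (EFin \o G).
  have cG : {in `[a, b], continuous G}.
    move=> y yab; apply: cvgD; last exact: cvg_cst.
    by apply: cvg_norm; exact: cf'0.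
  exact: integrableS (integrable_continuous_itv cG).
have Gub x y : I x -> `]a, b[%classic y -> `|partial1of2 f x y| <= G y.
  move=> /HI[_ dfx b1] yab; rewrite partial1of2E.
  have [_ ->] := dfx _ yab.
  have /b1/ltW b1y : y \in `[a, b] by exact: oc.
  rewrite /G -[X in `|X|](subrK (f' x0 y)) (le_trans (ler_normD _ _))// addrC.
  by rewrite lerD2l distrC.
have Eoc (h : R -> R) : {in `[a, b], continuous h} ->
    \int[mu]_(y in `[a, b]) h y = \int[mu]_(y in `]a, b[) h y.
  move=> ch.
  rewrite [RHS]Rintegral_itv_bndo_bndc; last first.
    by apply: integrableS (integrable_continuous_itv ch) => //.
  rewrite Rintegral_itv_obnd_cbnd//.
  apply: integrableS (integrable_continuous_itv ch) => //.
  exact: subset_itv_oc_cc.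
have H1 := @derivable_under_integral R _ _ mu f `]a, b[
  (measurable_itv _) x0 _ _ Ix0 intf derf G G0 intG Gub.
have H2 := @differentiation_under_integral R _ _ mu f `]a, b[
  (measurable_itv _) x0 _ _ Ix0 intf derf G G0 intG Gub.
have H : is_derive x0 1 (fun x => \int[mu]_(y in `]a, b[) f x y)
    (\int[mu]_(y in `[a, b]) f' x0 y).
  apply: DeriveDef => //; rewrite -derive1E H2 Eoc//.
  apply: eq_Rintegral => y /set_mem yab.
  rewrite -/(partial1of2 f x0 y) partial1of2E.
  by have [_ /(_ _ yab)[_ ->]] := HI _ Ix0.
apply: near_eq_is_derive H.
near=> x; apply/esym/Eoc.
by near: x.
Unshelve. all: by end_near. Qed.

Lemma integral_FTC (f F : R -> R) a b : a < b -> {in `[a, b], continuous f} ->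
  {in `]a, b[, forall x, is_derive (x : R) (1 : R) F (f x)} ->
  F @ a^'+ --> F a -> F @ b^'- --> F b ->
  \int[mu]_(x in `[a, b]) f x = F b - F a.
Proof.
move=> ab cf dF Fa Fb; rewrite /Rintegral (@continuous_FTC2 _ f F)//.
- by apply: continuous_in_subspaceT => x /set_mem; exact: cf.
- by split=> // x /dF [].
- by move=> x /dF [_ <-]; rewrite derive1E.
Qed.

End integrals.

(** * Rules for derivatives and continuity *)

Section derive_rules.
Variable R : realType.
Implicit Types (f g : R -> R) (x : R).

Lemma derive_mul f g x df dg : is_derive x 1 f df -> is_derive x 1 g dg ->
  is_derive x 1 (fun t => f t * g t) (df * g x + f x * dg).
Proof.
move=> Df Dg; apply: (is_derive_eq (is_deriveM Df Dg)).
by rewrite /GRing.scale/= addrC mulrC.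
Qed.

Lemma derive_add f g x df dg : is_derive x 1 f df -> is_derive x 1 g dg ->
  is_derive x 1 (fun t => f t + g t) (df + dg).
Proof. by move=> Df Dg; exact: is_deriveD. Qed.

Lemma derive_sub f g x df dg : is_derive x 1 f df -> is_derive x 1 g dg ->
  is_derive x 1 (fun t => f t - g t) (df - dg).
Proof. by move=> Df Dg; exact: is_deriveB. Qed.

Lemma derive_scale f x (k df : R) : is_derive x 1 f df ->
  is_derive x 1 (fun t => k * f t) (k * df).
Proof. by move=> Df; exact: is_deriveZ. Qed.

Lemma derive_affine f x (a b df : R) : is_derive (a + b * x) 1 f df ->
  is_derive x 1 (fun t => f (a + b * t)) (df * b).
Proof.
move=> Df.
have Da : is_derive x (1 : R) (fun t => a + b * t) b.
  apply: is_derive_eq (derive_add (is_derive_cst a x 1)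
    (derive_scale b (is_derive_id x 1))) _.
  by rewrite add0r mulr1.
exact: (@is_derive1_comp _ f (fun t => a + b * t)).
Qed.

Lemma derive_translate f x (h df : R) : is_derive (x + h) 1 f df ->
  is_derive x 1 (fun t => f (t + h)) df.
Proof.
move=> Df; have := @derive_affine f x h 1 df; rewrite mul1r addrC => /(_ Df).
by rewrite mulr1; under eq_fun do rewrite mul1r addrC.
Qed.

Lemma derive_reflect f x (h df : R) : is_derive (x - h) 1 f df ->
  is_derive h 1 (fun t => f (x - t)) (- df).
Proof.
move=> Df; have := @derive_affine f h x (-1) df; rewrite mulN1r => /(_ Df).
by rewrite mulrN1; under eq_fun do rewrite mulN1r.
Qed.

Lemma derive_continuous f x df : is_derive x 1 f df -> {for x, continuous f}.
Proof. by move=> [/derivable1_diffP/differentiable_continuous]. Qed.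

Lemma derive0_eq f a b : a <= b ->
  {in `[a, b], forall x : R, is_derive x 1 f 0} -> f a = f b.
Proof.
move=> ab Df; apply/esym/eqP; rewrite -subr_eq0; apply/eqP.
have [||x _ ->] := @MVT_segment R f (cst 0) a b ab; last by rewrite mul0r.
- by move=> x xab; apply: Df; exact: subset_itv_oo_cc.
- by apply: continuous_in_subspaceT => x /set_mem/Df; exact: derive_continuous.
Qed.

Lemma integral_FTC_continuous (f F : R -> R) a b : a < b ->
  {in `[a, b], continuous f} ->
  {in `[a, b], forall x : R, is_derive x 1 F (f x)} ->
  \int[@lebesgue_measure R]_(x in `[a, b]) f x = F b - F a.
Proof.
move=> ab cf dF; have cF x : x \in `[a, b] -> {for x, continuous F}.
  by move=> /dF; exact: derive_continuous.
apply: integral_FTC => //.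
- by move=> x /(@subset_itv_oo_cc _ _ a b); exact: dF.
- by apply/cvg_at_right_filter/cF; rewrite in_itv/= lexx ltW.
- by apply/cvg_at_left_filter/cF; rewrite in_itv/= lexx ltW.
Qed.

End derive_rules.

Section projections.
Variables (X T S : topologicalType).

Lemma continuous_fst (f : X -> T * S) x :
  {for x, continuous f} -> continuous_at x (fun x => (f x).1).
Proof. by move=> cf; apply: continuous_comp cf _; exact: cvg_fst. Qed.

Lemma continuous_snd (f : X -> T * S) x :
  {for x, continuous f} -> continuous_at x (fun x => (f x).2).
Proof. by move=> cf; apply: continuous_comp cf _; exact: cvg_snd. Qed.

Lemma continuous_var (x : X) : continuous_at x (fun x => x).
Proof. exact: cvg_id. Qed.

Lemma continuous_const (t : T) (x : X) : continuous_at x (fun=> t).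
Proof. exact: cvg_cst. Qed.

End projections.

Section pointwise.
Variables (R : realType) (X : topologicalType).
Implicit Types (f g : X -> R) (x : X).

Lemma continuous_add f g x : {for x, continuous f} -> {for x, continuous g} ->
  continuous_at x (fun x => f x + g x).
Proof. by move=> cf cg; exact: (cvgD cf cg). Qed.

Lemma continuous_sub f g x : {for x, continuous f} -> {for x, continuous g} ->
  continuous_at x (fun x => f x - g x).
Proof. by move=> cf cg; exact: (cvgB cf cg). Qed.

Lemma continuous_mul f g x : {for x, continuous f} -> {for x, continuous g} ->
  continuous_at x (fun x => f x * g x).
Proof. by move=> cf cg; exact: (cvgM cf cg). Qed.

Lemma continuous_opp f x : {for x, continuous f} ->
  continuous_at x (fun x => - f x).
Proof. by move=> cf; exact: (cvgN cf). Qed.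

Lemma continuous_horner (p : {poly R}) f x : {for x, continuous f} ->
  continuous_at x (fun x => p.[f x]).
Proof.
move=> cf; apply: (continuous_comp (f := f) (g := horner p)) => //.
exact: derive_continuous (is_derive_poly p _).
Qed.

End pointwise.

Lemma continuous_atE (X Y : topologicalType) (f : X -> Y) x :
  continuous_at x f -> {for x, continuous f}.
Proof. by []. Qed.

(** Continuity of compound expressions; [tac] deals with the atoms. The head
    symbol is matched syntactically, as letting unification try all the rules
    unfolds the integrals. *)
Ltac continuity_with tac :=
  lazymatch goal with
  | |- continuous_at ?x ?f =>
    lazymatch f with
    | (fun t => t) => exact: continuous_var
    | (fun t => (@?a t).1) => apply: continuous_fst; continuity_with tac
    | (fun t => (@?a t).2) => apply: continuous_snd; continuity_with tac
    | (fun t => @?a t + - @?b t) => apply: continuous_sub; continuity_with tac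
    | (fun t => @?a t + @?b t) => apply: continuous_add; continuity_with tac
    | (fun t => @?a t * @?b t) => apply: continuous_mul; continuity_with tac
    | (fun t => - @?a t) => apply: continuous_opp; continuity_with tac
    | (fun t => ?p.[@?a t]) => apply: continuous_horner; continuity_with tac
    | (fun _ => ?c) => exact: continuous_const
    | (fun t => _) => tac
    | horner ?p => exact: (derive_continuous (is_derive_poly p _))
    | +%R ?a => apply: (continuous_add (f := fun=> a)); continuity_with tac
    | *%R ?a => apply: (continuous_mul (f := fun=> a)); continuity_with tac
    | id => exact: continuous_var
    | fst => exact: cvg_fst
    | snd => exact: cvg_snd
    | _ => tac
    end
  | |- _ => apply: continuous_atE; continuity_with tac
  end.
Ltac continuity := continuity_with ltac:(by []).

(** * Green's identity on a cross-section *)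

Section green.
Variables (R : realType) (r : R).
Hypothesis r_gt0 : 0 < r.

Lemma near_norm_lt (x k : R) : `|x| < k -> \forall x' \near x, `|x'| < k.
Proof.
have cx : `|x'| @[x' --> x] --> `|x| by apply: cvg_norm; exact: cvg_id.
by move=> xk; exact: (@cvgr_lt _ _ _ (nbhs_filter x) (fun x' => `|x'|) _ cx _ xk).
Qed.

Lemma bounded_antiderivative (p q : R -> R) : continuous q ->
  (forall y, `|y| < r -> is_derive y (1 : R) p (q y)) ->
  exists2 B, 0 <= B & forall y, `|y| < r -> `|p y| <= B.
Proof.
move=> cq Dp; pose s (y : R) := `|q y|.
have cs : continuous s by move=> y; apply: cvg_norm; exact: cq.
have r0 : - r <= r by rewrite ltW ?gtrN.
have [m _ qm] := @EVT_max R s (- r) r r0 (continuous_subspaceT cs).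
have sm0 : 0 <= s m by rewrite /s.
exists (`|p 0| + s m * r); first by rewrite addr_ge0// mulr_ge0// ltW.
move=> y yr.
have bnd a b : `|a| < r -> `|b| < r -> a <= b -> `|p b - p a| <= s m * (b - a).
  move=> ar br ab.
  have win z : z \in `[a, b] -> `|z| < r.
    rewrite in_itv/= => /andP[az zb].
    move: ar br; rewrite !ltr_norml => /andP[? ?] /andP[? ?].
    by apply/andP; split; lra.
  have [||z zab ->] := @MVT_segment R p q a b ab.
  - by move=> z zab; apply: Dp; apply: win; exact: subset_itv_oo_cc.
  - apply: continuous_in_subspaceT => z /set_mem/win/Dp.
    exact: derive_continuous.
  rewrite normrM [X in _ * X]ger0_norm ?subr_ge0// ler_wpM2r ?subr_ge0//.
  apply: qm; have := win z zab; rewrite in_itv/= ltr_norml => /andP[? ?].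
  by apply/andP; split; exact: ltW.
suff H : `|p y - p 0| <= s m * r.
  by rewrite -[p y](subrK (p 0)) addrC (le_trans (ler_normD _ _))// lerD2l.
have n0 : `|0 : R| < r by rewrite normr0.
have [y0|y0] := leP 0 y.
  apply: le_trans (bnd 0 y n0 yr y0) _; rewrite subr0 ler_wpM2l//.
  by rewrite (le_trans (ler_norm _))// ltW.
rewrite distrC; apply: le_trans (bnd y 0 yr n0 (ltW y0)) _.
by rewrite sub0r ler_wpM2l// (le_trans (ler_norm _))// normrN ltW.
Qed.

(** Integrating [(p1 f2 - f1 p2)' = q1 f2 - f1 q2]. The boundary terms vanish
    although the functions are only known to be differentiable inside: the second
    derivatives are bounded, hence so are the first ones, and the functions
    tend to 0 at the ends. *)
Lemma green_itv (f1 f2 p1 p2 q1 q2 : R -> R) :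
  continuous f1 -> continuous f2 -> continuous q1 -> continuous q2 ->
  (forall y, `|y| = r -> f1 y = 0 /\ f2 y = 0) ->
  (forall y, `|y| < r ->
    is_derive y (1 : R) f1 (p1 y) /\ is_derive y (1 : R) p1 (q1 y)) ->
  (forall y, `|y| < r ->
    is_derive y (1 : R) f2 (p2 y) /\ is_derive y (1 : R) p2 (q2 y)) ->
  \int[@lebesgue_measure R]_(y in `[(- r), r]) (q1 y * f2 y - f1 y * q2 y) = 0.
Proof.
move=> cf1 cf2 cq1 cq2 f0 D1 D2.
have [B1 B10 hB1] := bounded_antiderivative cq1 (fun y yr => (D1 y yr).2).
have [B2 B20 hB2] := bounded_antiderivative cq2 (fun y yr => (D2 y yr).2).
pose E y := p1 y * f2 y - f1 y * p2 y.
have E0 y : `|y| = r -> E y = 0.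
  by move=> /f0[e1 e2]; rewrite /E e1 e2 mulr0 mul0r subrr.
have nr : `|r| = r by rewrite gtr0_norm.
have nNr : `|- r| = r by rewrite normrN.
have limE (F : set_system R) y0 : Filter F -> F --> y0 -> `|y0| = r ->
    (\forall y \near F, `|y| < r) -> E @ F --> E y0.
  move=> FF Fy0 y0r Fr; rewrite E0//; apply: norm_cvg0.
  have [e1 e2] := f0 _ y0r.
  have Fcvg (f : R -> R) : continuous f -> f y0 = 0 -> `|f y| @[y --> F] --> 0.
    move=> cf f00; rewrite -(normr0 R) -f00.
    by apply: cvg_norm; exact: (cvg_comp _ _ Fy0 (cf y0)).
  have F0 : B1 * `|f2 y| + B2 * `|f1 y| @[y --> F] --> B1 * 0 + B2 * 0.
    by apply: cvgD; apply: cvgM; first [exact: cvg_cst|exact: Fcvg].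
  rewrite !mulr0 addr0 in F0.
  apply: (@squeeze_cvgr _ _ _ _ (cst 0) _ _ _ _ _ F0); last exact: cvg_cst.
  near=> y.
  have yr : `|y| < r by near: y.
  rewrite /= normr_ge0 (le_trans (ler_normB _ _))// !normrM lerD//.
    by rewrite ler_wpM2r// hB1.
  by rewrite mulrC ler_wpM2r// hB2.
have ci y : {for y, continuous (fun y => q1 y * f2 y - f1 y * q2 y)}.
  apply: continuous_sub; apply: continuous_mul.
  - exact: cq1.
  - exact: cf2.
  - exact: cf1.
  - exact: cq2.
rewrite (@integral_FTC _ _ E); first by rewrite !E0// subrr.
- by rewrite gtrN.
- by move=> y _; exact: ci.
- move=> y; rewrite in_itv/= -ltr_norml => yr.
  have [d1 d1'] := D1 y yr; have [d2 d2'] := D2 y yr.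
  apply: is_derive_eq (derive_sub (derive_mul d1' d2) (derive_mul d1 d2')) _.
  ring.
- apply: limE => //; first exact: cvg_at_right_filter.
  near=> y; rewrite ltr_norml; apply/andP; split.
    by near: y; exact: nbhs_right_gt.
  by near: y; apply: nbhs_right_lt; rewrite gtrN.
- apply: limE => //; first exact: cvg_at_left_filter.
  near=> y; rewrite ltr_norml; apply/andP; split; last first.
    by near: y; exact: nbhs_left_lt.
  by near: y; apply: nbhs_left_gt; rewrite gtrN.
Unshelve. all: by end_near. Qed.

End green.

(** * The parallelogram law, by tangential mollification *)

Section mollified.
Variables (R : realType) (l r lam : R).
Hypotheses (r_gt0 : 0 < r).
Variables (g gx gxx gy gyy : R -> R -> R).
Hypothesis cg : forall x y, continuous2_at g x y.
Hypothesis Dgx : forall x y, `|x| < l -> `|y| < r ->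
  is_derive x (1 : R) (g ^~ y) (gx x y) /\ is_derive x (1 : R) (gx ^~ y) (gxx x y).
Hypothesis Dgy : forall x y, `|x| < l -> `|y| < r ->
  is_derive y (1 : R) (g x) (gy x y) /\ is_derive y (1 : R) (gy x) (gyy x y).
Hypothesis c1 : forall x y, `|x| < l -> `|y| < r ->
  continuous2_at gx x y /\ continuous2_at gy x y.
Hypothesis c2 : forall x y, `|x| < l -> `|y| < r ->
  continuous2_at gxx x y /\ continuous2_at gyy x y.
Hypothesis pde : forall x y, `|x| < l -> `|y| < r ->
  gxx x y + gyy x y = - lam * g x y.
Hypothesis bdry : forall x y, `|x| < l -> `|y| = r -> g x y = 0.

Notation mu := (@lebesgue_measure R).

(** Averaging in [x] only, at scale [eta], with weight [p]. At [eta = 0] this is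
    a multiple of [f], so that letting [eta] tend to 0 is mere continuity. The
    derivatives of the average come from other polynomial weights. *)
Definition smear (p : {poly R}) (f : R -> R -> R) (eta x y : R) : R :=
  \int[mu]_(t in `[(-1), 1]) (p.[t] * f (x + eta * t) y).

(** [(1 - X^2)^2]: its double zeros at the ends of [[-1, 1]] allow two
    integrations by parts without boundary terms. *)
Definition bump : {poly R} := 1 - 'X^2 *+ 2 + 'X^4.

Lemma smear_window eta x t : 0 <= eta -> `|x| + eta < l ->
  t \in `[(-1), 1] -> `|x + eta * t| < l.
Proof.
move=> eta0 xl; rewrite in_itv/= -ler_norml => t1.
apply: le_lt_trans xl; rewrite (le_trans (ler_normD _ _))// lerD2l normrM.
by rewrite (ger0_norm eta0) ler_piMr.
Qed.

Lemma continuous_smear (p : {poly R}) (z : R * R * R) :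
  {for z, continuous (fun z : R * R * R => smear p g z.1.1 z.1.2 z.2)}.
Proof.
have cf (z' : R * R * R) t :
    continuous2_at (fun (z : R * R * R) t => p.[t] * g (z.1.2 + z.1.1 * t) z.2) z' t.
  apply: continuous_mul; first by continuity.
  by apply: (continuous2_comp (f := g) (p := fun w : R * R * R * R =>
    w.1.1.2 + w.1.1.1 * w.2) (q := fun w => w.1.2)); last exact: cg; continuity.
apply: (continuous_integral
  (f := fun (z : R * R * R) t => p.[t] * g (z.1.2 + z.1.1 * t) z.2)).
  by apply: filterE => z' t _; exact: continuous2_slice (cf z' t).
by move=> t _; exact: cf.
Qed.

Section tangential.
Variables (f fx : R -> R -> R) (y eta : R).
Hypothesis eta_gt0 : 0 < eta.
Hypothesis Df : forall x, `|x| < l -> is_derive x (1 : R) (f ^~ y) (fx x y).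
Hypothesis cfx : forall x, `|x| < l -> {for x, continuous (fx ^~ y)}.

Let cf x : `|x| < l -> {for x, continuous (f ^~ y)}.
Proof. by move=> /Df; exact: derive_continuous. Qed.

Let continuous_integrand (p : {poly R}) (h : R -> R) x t :
  (forall x, `|x| < l -> {for x, continuous h}) -> `|x| + eta < l ->
  t \in `[(-1), 1] -> {for t, continuous (fun t => p.[t] * h (x + eta * t))}.
Proof.
move=> ch xl t1; apply: continuous_mul; first by continuity.
apply: (continuous_comp (f := fun t => x + eta * t) (g := h)); first by continuity.
by apply: ch; apply: smear_window => //; exact: ltW.
Qed.

Lemma derive_smear_tangential (p : {poly R}) x : `|x| + eta < l ->
  is_derive x (1 : R) (fun x => smear p f eta x y) (smear p fx eta x y).
Proof.
move=> xl.
apply: (@is_derive_integral R (fun x t => p.[t] * f (x + eta * t) y)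
   (fun x t => p.[t] * fx (x + eta * t) y)).
- have : `|x| < l - eta by rewrite ltrBrDr.
  move=> /near_norm_lt; apply: filterS => x'; rewrite ltrBrDr => x'l t t1.
  exact: (continuous_integrand (h := f ^~ y) cf).
- have : `|x| < l - eta by rewrite ltrBrDr.
  move=> /near_norm_lt; apply: filterS => x'; rewrite ltrBrDr => x'l t t1.
  have /Df D : `|x' + eta * t| < l.
    by apply: smear_window => //; [exact: ltW|exact: subset_itv_oo_cc].
  have := @derive_affine R (f ^~ y) x' (eta * t) 1 (fx (x' + eta * t) y).
  rewrite mul1r addrC => /(_ D); rewrite mulr1 => /(derive_scale p.[t]).
  by under [X in is_derive _ _ X]eq_fun do rewrite mul1r addrC.
- by move=> t t1; exact: (continuous_integrand (h := fx ^~ y) cfx).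
- move=> t t1; apply: continuous_mul; first by continuity.
  apply: (continuous_comp (f := fun w => w.1 + eta * w.2) (g := fx ^~ y)).
    by continuity.
  by apply: cfx; apply: smear_window => //; exact: ltW.
Qed.

(** The derivative moves from the function to the weight. *)
Lemma smear_by_parts (p : {poly R}) x : `|x| + eta < l ->
  p.[1] = 0 -> p.[-1] = 0 ->
  smear p fx eta x y = - eta^-1 * smear p^`() f eta x y.
Proof.
move=> xl p1 pN1.
have Ifx : mu.-integrable `[(-1), 1]
    (EFin \o (fun t => p.[t] * fx (x + eta * t) y)).
  apply: integrable_continuous_itv => t t1.
  exact: (continuous_integrand (h := fx ^~ y) cfx).
have cp' t : t \in `[(-1), 1] ->
    {for t, continuous (fun t => p^`().[t] * f (x + eta * t) y)}.
  by move=> t1; exact: (continuous_integrand (h := f ^~ y) cf).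
have If := integrable_continuous_itv cp'.
suff : smear p^`() f eta x y + eta * smear p fx eta x y = 0.
  move=> /eqP; rewrite addr_eq0 => /eqP ->; rewrite mulNr mulrN opprK mulrA.
  by rewrite mulVf ?mul1r// gt_eqF.
have cpe t : t \in `[(-1), 1] ->
    {for t, continuous (fun t => eta * (p.[t] * fx (x + eta * t) y))}.
  move=> t1; apply: continuous_mul; first by continuity.
  exact: (continuous_integrand (h := fx ^~ y) cfx).
rewrite /smear -RintegralZl// -RintegralD//; last exact: integrable_continuous_itv.
rewrite (@integral_FTC_continuous _ _ (fun t => p.[t] * f (x + eta * t) y)).
- by rewrite p1 pN1 !mul0r subrr.
- by lra.
- by move=> t t1; exact: (continuous_add (cp' t t1) (cpe t t1)).
- move=> t t1.
  have /Df D : `|x + eta * t| < l by apply: smear_window => //; exact: ltW.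
  apply: is_derive_eq (derive_mul (is_derive_poly p t) (derive_affine D)) _.
  by rewrite [fx _ _ * _]mulrC mulrCA.
Qed.

End tangential.

Lemma derive_smear_normal (p : {poly R}) (f fy : R -> R -> R) eta x y :
  0 < eta -> `|x| + eta < l -> `|y| < r ->
  (forall x y, `|x| < l -> `|y| < r -> is_derive y (1 : R) (f x) (fy x y)) ->
  (forall x y, `|x| < l -> `|y| < r ->
     continuous2_at f x y /\ continuous2_at fy x y) ->
  is_derive y (1 : R) (smear p f eta x) (smear p fy eta x y).
Proof.
move=> eta0 xl yr Df cf.
have win t : t \in `[(-1), 1] -> `|x + eta * t| < l.
  by move=> t1; apply: smear_window => //; exact: ltW.
have c2f (h : R -> R -> R) y' t : continuous2_at h (x + eta * t) y' ->
    continuous2_at (fun y t => p.[t] * h (x + eta * t) y) y' t.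
  move=> ch; apply: continuous_mul; first by continuity.
  by apply: (continuous2_comp (f := h) (p := fun w : R * R => x + eta * w.2)
    (q := fun w => w.1)); last exact: ch; continuity.
apply: (@is_derive_integral R (fun y t => p.[t] * f (x + eta * t) y)
   (fun y t => p.[t] * fy (x + eta * t) y)).
- move: yr => /near_norm_lt; apply: filterS => y' y'r t t1.
  by apply: (continuous2_slice (c2f f _ _ _)); have [] := cf _ _ (win t t1) y'r.
- move: yr => /near_norm_lt; apply: filterS => y' y'r t t1.
  by apply: derive_scale; apply: Df => //; exact/win/subset_itv_oo_cc.
- move=> t t1.
  by apply: (continuous2_slice (c2f fy _ _ _)); have [] := cf _ _ (win t t1) yr.
- by move=> t t1; apply: c2f; have [] := cf _ _ (win t t1) yr.
Qed.

Lemma continuous_smear_comp (T : topologicalType) (p : {poly R})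
    (a b c : T -> R) z :
  {for z, continuous a} -> {for z, continuous b} -> {for z, continuous c} ->
  {for z, continuous (fun z => smear p g (a z) (b z) (c z))}.
Proof.
move=> ca cb cc.
have cz : {for z, continuous (fun z => ((a z, b z), c z))}.
  exact: cvg_pair (cvg_pair ca cb) cc.
exact: (continuous_comp (f := fun z => ((a z, b z), c z))
  (g := fun z : R * R * R => smear p g z.1.1 z.1.2 z.2) cz (@continuous_smear p _)).
Qed.

Lemma bump_ends :
  [/\ bump.[1] = 0, bump.[-1] = 0, bump^`().[1] = 0 & bump^`().[-1] = 0].
Proof.
by rewrite /bump !poly.derivE; split; rewrite ?(hornerD, hornerN, hornerMn,
  hornerXn, hornerC, hornerX, horner0, hornerM) /=; ring.
Qed.

Lemma integral_bump : \int[mu]_(t in `[(-1), 1]) bump.[t] = 16 / 15.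
Proof.
pose P : {poly R} := 'X - (2 / 3) *: 'X^3 + (1/5) *: 'X^5.
transitivity (P.[1] - P.[-1]); last first.
  by rewrite /P ?(hornerD, hornerN, hornerZ, hornerXn, hornerX); field.
apply: integral_FTC_continuous => [|t _|t _]; first lra.
  exact: derive_continuous (is_derive_poly _ t).
apply: is_derive_eq (is_derive_poly _ t) _.
by rewrite /P /bump !poly.derivE ?(hornerD, hornerN, hornerMn, hornerXn,
  hornerC, hornerX, horner0, hornerZ, hornerM) /=; field.
Qed.

Definition mollify eta := smear bump g eta.

(** The tangential derivatives of [mollify], in the form given by integration by
    parts: they involve the values of [g] only, hence are continuous up to the
    free sides. *)
Definition mollify_x eta x y := - eta^-1 * smear bump^`() g eta x y.
Definition mollify_xx eta x y := eta^-1 ^+ 2 * smear bump^`()^`() g eta x y.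

Lemma derive_mollify_tangential eta x y :
  0 < eta -> `|x| + eta < l -> `|y| < r ->
  is_derive x (1 : R) (mollify eta ^~ y) (mollify_x eta x y) /\
  is_derive x (1 : R) (mollify_x eta ^~ y) (mollify_xx eta x y).
Proof.
move=> eta0 xl yr; have [b1 bN1 b'1 b'N1] := bump_ends.
have D x' : `|x'| < l -> is_derive x' (1 : R) (g ^~ y) (gx x' y).
  by move=> x'l; have [] := Dgx x'l yr.
have c x' : `|x'| < l -> {for x', continuous (gx ^~ y)}.
  by move=> x'l; have [_ /derive_continuous] := Dgx x'l yr.
have d p : p.[1] = 0 -> p.[-1] = 0 ->
    is_derive x (1 : R) (fun x => smear p g eta x y)
      (- eta^-1 * smear p^`() g eta x y).
  move=> p1 pN1; have <- : smear p gx eta x y = - eta^-1 * smear p^`() g eta x y.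
    exact: smear_by_parts.
  exact: derive_smear_tangential.
split; first exact: d.
have := derive_scale (- eta^-1) (d _ b'1 b'N1).
by rewrite mulrA mulrNN.
Qed.

(** The equation turns the second normal derivative into [- lam g - gxx]; after
    averaging, the second term is [mollify_xx]. So this derivative extends
    continuously to the free sides, near which nothing is known on [gyy]. *)
Lemma derive_mollify_normal eta x y : 0 < eta -> `|x| + eta < l -> `|y| < r ->
  is_derive y (1 : R) (mollify eta x) (smear bump gy eta x y) /\
  is_derive y (1 : R) (smear bump gy eta x)
    (- lam * mollify eta x y - mollify_xx eta x y).
Proof.
move=> eta0 xl yr; have [b1 bN1 b'1 b'N1] := bump_ends; split.
  apply: derive_smear_normal => // x' y' x'l y'r; first by have [] := Dgy x'l y'r.
  by split; [exact: cg|have [] := c1 x'l y'r].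
have -> : - lam * mollify eta x y - mollify_xx eta x y = smear bump gyy eta x y.
  have <- : smear bump gxx eta x y = mollify_xx eta x y.
    have -> : smear bump gxx eta x y = - eta^-1 * smear bump^`() gx eta x y.
      apply: smear_by_parts => // x' x'l; first by have [] := Dgx x'l yr.
      have [cxx _] := c2 x'l yr.
      by apply: (continuous2_comp (p := id) (q := fun=> y)) cxx;
        [exact: cvg_id|exact: cvg_cst].
    have -> : smear bump^`() gx eta x y = - eta^-1 * smear bump^`()^`() g eta x y.
      apply: smear_by_parts => // x' x'l; first by have [] := Dgx x'l yr.
      by have [_ /derive_continuous] := Dgx x'l yr.
    by rewrite /mollify_xx mulrA mulrNN.
  have win t : t \in `[(-1), 1] -> `|x + eta * t| < l.
    by move=> t1; apply: smear_window => //; exact: ltW.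
  have ig (h : R -> R -> R) : (forall x, `|x| < l -> continuous2_at h x y) ->
      mu.-integrable `[(-1), 1]
        (EFin \o (fun t => bump.[t] * h (x + eta * t) y)).
    move=> ch; apply: integrable_continuous_itv => t t1.
    apply: continuous_mul; first by continuity.
    apply: (continuous2_comp (f := h) (p := fun t => x + eta * t) (q := fun=> y));
      [by continuity|by continuity|exact/ch/win].
  have igg : mu.-integrable `[(-1), 1]
      (EFin \o (fun t => bump.[t] * g (x + eta * t) y)).
    by apply: ig => x' _; exact: cg.
  rewrite /mollify /smear -RintegralZl// -RintegralB//; last 2 first.
  - have ci t : {for t, continuous
        (fun t => - lam * (bump.[t] * g (x + eta * t) y))}.
      apply: continuous_mul; first by continuity.
      apply: continuous_mul; first by continuity.
      apply: (continuous2_comp (f := g) (p := fun t => x + eta * t)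
        (q := fun=> y)); [by continuity|by continuity|exact: cg].
    by apply: integrable_continuous_itv => t t1; exact: ci.
  - by apply: ig => x' x'l; have [] := c2 x'l yr.
  apply: eq_Rintegral => t /set_mem/win tl; have := pde tl yr.
  rewrite addrC => /(canRL (addrK _)) ->; ring.
apply: derive_smear_normal => // x' y' x'l y'r; first by have [] := Dgy x'l y'r.
by have [_ ?] := c1 x'l y'r; have [_ ?] := c2 x'l y'r.
Qed.

(** The wave equation for the correlation of two cross-sections: by Green's
    identity [mollify_xx] may be replaced by the second normal derivative plus
    [lam] times the function, and the terms in [lam] cancel. *)
Lemma green_smear eta x s : 0 < eta -> `|x| + eta < l -> `|s| + eta < l ->
  \int[mu]_(y in `[(- r), r]) (mollify_xx eta x y * mollify eta s y -
    mollify eta x y * mollify_xx eta s y) = 0.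
Proof.
move=> eta0 xl sl.
have cs p x' y : {for y, continuous (fun y => smear p g eta x' y)}.
  by apply: continuous_smear_comp; continuity.
have cU x' : continuous (mollify eta x') by move=> y; exact: cs.
have cUxx x' : continuous (mollify_xx eta x').
  move=> y; suff : {for y, continuous (fun y =>
      eta^-1 ^+ 2 * smear bump^`()^`() g eta x' y)} by [].
  by apply: continuous_mul; [continuity|exact: cs].
have U0 x' y : `|x'| + eta < l -> `|y| = r -> mollify eta x' y = 0.
  move=> x'l yr; rewrite /mollify /smear (@eq_Rintegral _ _ _ mu _ (fun=> 0)).
    by rewrite Rintegral_cst ?mul0r.
  move=> t /set_mem t1; rewrite bdry ?mulr0//.
  by apply: smear_window => //; exact: ltW.
have cq x' : continuous (fun y => - lam * mollify eta x' y - mollify_xx eta x' y).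
  move=> y; suff : {for y, continuous (fun y =>
      - lam * mollify eta x' y - mollify_xx eta x' y)} by [].
  apply: continuous_sub; last exact: cUxx.
  by apply: continuous_mul; [continuity|exact: cU].
rewrite -[RHS](@green_itv _ _ r_gt0 (mollify eta s) (mollify eta x)
  (smear bump gy eta s) (smear bump gy eta x) _ _ (cU s) (cU x) (cq s) (cq x)).
- by apply: eq_Rintegral => y _; ring.
- by move=> y yr; rewrite !U0.
- by move=> y yr; exact: derive_mollify_normal.
- by move=> y yr; exact: derive_mollify_normal.
Qed.

Ltac smear_continuity :=
  continuity_with ltac:(idtac; lazymatch goal with
    | |- continuous_at _ (smear ?p g ?eta0 ?x0) =>
      refine (@continuous_smear_comp _ p (fun _ => eta0) (fun _ => x0) id _ _ _ _);
      smear_continuity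
    | |- continuous_at _ (fun t => smear ?p g (@?a t) (@?b t) (@?c t)) =>
      refine (@continuous_smear_comp _ p a b c _ _ _ _); smear_continuity
    end).

(** The derivative in [h] of the correlation of the cross-sections at [x + h] and
    [x - h]. Its derivative in [x] is the integral of [green_smear]. *)
Definition skew (eta x h : R) := \int[mu]_(y in `[(- r), r])
  (mollify_x eta (x + h) y * mollify eta (x - h) y -
   mollify eta (x + h) y * mollify_x eta (x - h) y).

Lemma skew_window (eta x h : R) : `|x| + `|h| + eta < l ->
  `|x + h| + eta < l /\ `|x - h| + eta < l.
Proof.
move=> xl; split; apply: le_lt_trans xl; rewrite lerD2r.
  exact: ler_normD.
exact: ler_normB.
Qed.

Lemma skew_const eta x x' h : 0 < eta ->
  `|x| + `|h| + eta < l -> `|x'| + `|h| + eta < l -> skew eta x h = skew eta x' h.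
Proof.
move=> eta0; wlog xx' : x x' / x <= x'.
  move=> H xl x'l; have [|/ltW] := leP x x'; first by move/H; apply.
  by move=> /H H'; apply/esym/H'.
move=> xl x'l; apply: (derive0_eq (f := skew eta ^~ h)) => // z.
rewrite in_itv/= => /andP[xz zx'].
have zl : `|z| < l - (`|h| + eta).
  have : `|x| < l - (`|h| + eta) by rewrite ltrBrDr addrA.
  have : `|x'| < l - (`|h| + eta) by rewrite ltrBrDr addrA.
  by rewrite !ltr_norml => /andP[? ?] /andP[? ?]; apply/andP; split; lra.
have win (w : R) : `|w| < l - (`|h| + eta) ->
    `|w + h| + eta < l /\ `|w - h| + eta < l.
  by rewrite ltrBrDr addrA => /skew_window.
have [zhl zhl'] := win _ zl.
rewrite -(green_smear eta0 zhl zhl').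
apply: (@is_derive_integral R
  (fun z y => mollify_x eta (z + h) y * mollify eta (z - h) y -
    mollify eta (z + h) y * mollify_x eta (z - h) y)
  (fun z y => mollify_xx eta (z + h) y * mollify eta (z - h) y -
    mollify eta (z + h) y * mollify_xx eta (z - h) y)).
- apply: filterE => z' y _; rewrite /mollify /mollify_x; smear_continuity.
- have := near_norm_lt zl; apply: filterS => w /win[wl wl'] y.
  rewrite in_itv/= -ltr_norml => yr.
  have [d1 d2] := derive_mollify_tangential eta0 wl yr.
  have [d1' d2'] := derive_mollify_tangential eta0 wl' yr.
  apply: is_derive_eq (derive_sub
    (derive_mul (derive_translate d2) (derive_translate d1'))
    (derive_mul (derive_translate d1) (derive_translate d2'))) _.
  ring.
- by move=> y _; rewrite /mollify /mollify_xx; smear_continuity.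
- by move=> y _; rewrite /mollify /mollify_xx /continuous2_at; smear_continuity.
Qed.

Definition pairing (f : R -> R -> R) x s :=
  \int[mu]_(y in `[(- r), r]) (f x y * f s y).

Lemma derive_pairing eta x h : 0 < eta -> `|x| + `|h| + eta < l ->
  is_derive h (1 : R) (fun h => pairing (mollify eta) (x + h) (x - h))
    (skew eta x h).
Proof.
move=> eta0 xl.
apply: (@is_derive_integral R
  (fun h y => mollify eta (x + h) y * mollify eta (x - h) y)
  (fun h y => mollify_x eta (x + h) y * mollify eta (x - h) y -
    mollify eta (x + h) y * mollify_x eta (x - h) y)).
- apply: filterE => z' y _; rewrite /mollify; smear_continuity.
- have : `|h| < l - (`|x| + eta) by rewrite ltrBrDr addrA (addrC `|h|).
  move/near_norm_lt; apply: filterS => t; rewrite ltrBrDr addrA (addrC `|t|).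
  move=> /skew_window[tl tl'] y; rewrite in_itv/= -ltr_norml => yr.
  have [+ _] := derive_mollify_tangential eta0 tl yr; rewrite addrC => d1.
  have [d1' _] := derive_mollify_tangential eta0 tl' yr.
  have := derive_mul (derive_translate d1) (derive_reflect d1').
  rewrite mulrN addrC.
  by under eq_fun do rewrite (addrC _ x).
- by move=> y _; rewrite /mollify /mollify_x; smear_continuity.
- by move=> y _; rewrite /mollify /mollify_x /continuous2_at; smear_continuity.
Qed.

(** Both sides agree at [h = 0] and have the same derivative in [h]. *)
Lemma parallelogram_smear eta x x' h : 0 < eta -> 0 <= h ->
  `|x| + h + eta < l -> `|x'| + h + eta < l ->
  pairing (mollify eta) x x - pairing (mollify eta) (x + h) (x - h) =
  pairing (mollify eta) x' x' - pairing (mollify eta) (x' + h) (x' - h).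
Proof.
move=> eta0 h0 xl x'l.
pose D t := pairing (mollify eta) (x + t) (x - t) -
  pairing (mollify eta) (x' + t) (x' - t).
suff : D 0 = D h.
  have swap (a b c d : R) : a - b = c - d -> a - c = b - d by lra.
  by rewrite /D !subr0 !addr0 => /swap.
apply: derive0_eq => // t; rewrite in_itv/= => /andP[t0 th].
have tl (z : R) : `|z| + h + eta < l -> `|z| + `|t| + eta < l.
  by apply: le_lt_trans; rewrite lerD2r lerD2l ger0_norm.
apply: is_derive_eq (derive_sub (derive_pairing eta0 (tl _ xl))
  (derive_pairing eta0 (tl _ x'l))) _.
by rewrite (skew_const eta0 (tl _ xl) (tl _ x'l)) subrr.
Qed.

(** The limit of [parallelogram_smear] as [eta] tends to 0; strict inequalities
    leave room for small [eta]. *)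
Lemma parallelogram x x' h : 0 <= h -> `|x| + h < l -> `|x'| + h < l ->
  pairing g x x - pairing g (x + h) (x - h) =
  pairing g x' x' - pairing g (x' + h) (x' - h).
Proof.
move=> h0 xl x'l.
pose P eta a b := pairing (mollify eta) a b.
pose D eta := P eta x x - P eta (x + h) (x - h) -
  (P eta x' x' - P eta (x' + h) (x' - h)).
have U0 a y : mollify 0 a y = 16 / 15 * g a y.
  rewrite -integral_bump /mollify /smear -RintegralZr//; last first.
    apply: integrable_continuous_itv => t _.
    exact: derive_continuous (is_derive_poly _ t).
  by apply: eq_Rintegral => t _; rewrite mul0r addr0.
have cP a b : {for (0 : R), continuous (fun eta => P eta a b)}.
  apply: (continuous_integral (f := fun eta y => mollify eta a y * mollify eta b y)).
  - by apply: filterE => eta y _; rewrite /mollify; smear_continuity.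
  - by move=> y _; rewrite /mollify /continuous2_at; smear_continuity.
have cD : {for (0 : R), continuous D}.
  by rewrite /D; apply: continuous_sub; apply: continuous_sub; exact: cP.
have P0 a b : P 0 a b = (16 / 15) ^+ 2 * pairing g a b.
  rewrite /P /pairing -RintegralZl//; last first.
    have cgg y : {for y, continuous (fun y => g a y * g b y)}.
      have cga c : {for y, continuous (g c)} := continuous2_slice (@cg c y).
      by apply: continuous_mul; exact: cga.
    by apply: integrable_continuous_itv => y _; exact: cgg.
  by apply: eq_Rintegral => y _; rewrite !U0; ring.
have D0 : D 0 = 0.
  have D1 : D @ (0 : R)^'+ --> D 0 by exact: cvg_at_right_filter.
  have D2 : D @ (0 : R)^'+ --> (0 : R).
    apply: cvg_near_cst; near=> eta; apply/eqP; rewrite subr_eq0; apply/eqP.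
    have eta0 : 0 < eta by near: eta; exact: nbhs_right_gt.
    apply: parallelogram_smear => //; rewrite -ltrBrDl; near: eta;
      by apply: nbhs_right_lt; rewrite subr_gt0.
  exact: (cvg_unique _ D1 D2).
move: D0; rewrite /D !P0 -!mulrBr => /eqP; rewrite mulf_eq0 => /orP[|].
  by rewrite expf_eq0/= mulf_eq0 invr_eq0 !pnatr_eq0.
by rewrite subr_eq0 => /eqP.
Unshelve. all: by end_near. Qed.

Lemma continuous_pairing (T : topologicalType) (a b : T -> R) z :
  continuous a -> continuous b ->
  {for z, continuous (fun z => pairing g (a z) (b z))}.
Proof.
move=> ca cb.
have cgc (c : T -> R) (w : T * R) : continuous c ->
    {for w, continuous (fun w => g (c w.1) w.2)}.
  move=> cc; apply: (continuous2_comp (p := fun w : T * R => c w.1) (q := snd)) (@cg _ _).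
  - by apply: continuous_comp; [exact: cvg_fst|exact: cc].
  - exact: cvg_snd.
have cp z' y : continuous2_at (fun z y => g (a z) y * g (b z) y) z' y.
  by apply: continuous_mul; exact: cgc.
apply: (continuous_integral (f := fun z y => g (a z) y * g (b z) y)).
  by apply: filterE => z' y _; exact: continuous2_slice (@cp z' y).
by move=> y _; exact: cp.
Qed.

Lemma continuous_product x s y : {for y, continuous (fun y => g x y * g s y)}.
Proof.
have cga c : {for y, continuous (g c)} := continuous2_slice (@cg c y).
by apply: continuous_mul; exact: cga.
Qed.

Lemma integrable_pairing x s :
  mu.-integrable `[(- r), r] (EFin \o (fun y => g x y * g s y)).
Proof. by apply: integrable_continuous_itv => y _; exact: continuous_product. Qed.

Lemma pairing_ge0 x : 0 <= pairing g x x.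
Proof. by apply: Rintegral_ge0 => y _; rewrite -expr2 sqr_ge0. Qed.

Lemma pairing_AMGM x s : `|pairing g x s| <= (pairing g x x + pairing g s s) / 2.
Proof.
have ixs := integrable_pairing x s.
have ixx := integrable_pairing x x.
have iss := integrable_pairing s s.
have cD y : {for y, continuous (fun y => g x y * g x y + g s y * g s y)}.
  by apply: continuous_add; exact: continuous_product.
have cD2 y :
    {for y, continuous (fun y => 2^-1 * (g x y * g x y + g s y * g s y))}.
  by apply: continuous_mul; [exact: cvg_cst|exact: cD].
have iD := integrable_continuous_itv (a := - r) (b := r) (fun y _ => cD y).
apply: le_trans (le_normr_Rintegral _ ixs) _ => //.
rewrite mulrC -RintegralD// -RintegralZl//.
apply: le_Rintegral => //.
- exact: integrable_norm.
- by apply: integrable_continuous_itv => y _; exact: cD2.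
move=> y _; rewrite [leRHS]mulrC ler_pdivlMr// normrM.
have := sqr_ge0 (`|g x y| - `|g s y|).
rewrite -!expr2 -[X in _ -> _ <= X + _]real_normK ?num_real//.
rewrite -[X in _ -> _ <= _ + X]real_normK ?num_real//.
by move: `|g x y| `|g s y| => p q; nra.
Qed.

(** By the parallelogram law, [F x - w (x + h, x - h)] equals the same quantity
    at [z], which is bounded by the values of [F] at [z - h], [z] and [z + h]. *)
Lemma pairing_submean x z h : 0 <= h -> `|x| + h < l -> `|z| + h < l ->
  pairing g x x <= (pairing g (x + h) (x + h) + pairing g (x - h) (x - h)) / 2 +
   (pairing g z z + (pairing g (z + h) (z + h) + pairing g (z - h) (z - h)) / 2).
Proof.
move=> h0 xl zl.
have := parallelogram h0 xl zl.
have := ler_normlW (pairing_AMGM (x + h) (x - h)).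
have := pairing_AMGM (z + h) (z - h); rewrite ler_norml => /andP[+ _].
move: (pairing g x x) (pairing g z z) (pairing g (x + h) (x - h))
  (pairing g (z + h) (z - h)) (pairing g (x + h) (x + h))
  (pairing g (x - h) (x - h)) (pairing g (z + h) (z + h))
  (pairing g (z - h) (z - h)) => *; lra.
Qed.

End mollified.

(** * Almost convex sequences and functions *)

Section discrete_convexity.
Variable R : realFieldType.

(** Once a convex sequence increases, it increases up to the last term; where it
    decreases, it has decreased from the first term on. *)
Lemma convex_seq_le_ends (b : nat -> R) n :
  (forall j, (j.+2 <= n)%N -> b j.+1 *+ 2 <= b j + b j.+2) ->
  forall j, (j <= n)%N -> b j <= Num.max (b 0) (b n).
Proof.
move=> cvx.
have up j : (j.+2 <= n)%N -> b j <= b j.+1 -> b j.+1 <= b j.+2.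
  by move=> jn; have := cvx j jn; rewrite mulr2n => *; lra.
have right k j : (j + k.+1 = n)%N -> b j <= b j.+1 -> b j.+1 <= b n.
  elim: k j => [|k IH] j jn bj; first by rewrite -jn addn1.
  have jn1 : (j.+1 + k.+1 = n)%N by rewrite addSnnS.
  have bj1 : b j.+1 <= b j.+2.
    by apply: up bj; rewrite -jn1 addnS ltnS leq_addr.
  exact: le_trans bj1 (IH _ jn1 bj1).
have left j : (j < n)%N -> b j.+1 < b j -> b j <= b 0.
  elim: j => [//|j IH] jn bj.
  have bj1 : b j.+1 < b j.
    by rewrite ltNge; apply/negP => /(up _ jn); rewrite leNgt bj.
  exact: le_trans (ltW bj1) (IH (ltnW jn) bj1).
move=> j; rewrite leq_eqVlt => /predU1P[->|jn]; rewrite le_max ?lexx ?orbT//=.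
apply/orP; have [bj|bj] := leP (b j) (b j.+1).
  have e : (j + (n - j).-1.+1 = n)%N by rewrite prednK ?subn_gt0// subnKC// ltnW.
  by right; exact: le_trans bj (right _ _ e bj).
by left; exact: left.
Qed.

(** Adding [j^2 K], whose second difference is [2 K], makes the sequence
    convex. *)
Lemma almost_convex_seq_le_ends (a : nat -> R) (K : R) n :
  (forall j, 0 <= a j) -> 0 <= K ->
  (forall j, (j.+2 <= n)%N -> a j.+1 <= (a j + a j.+2) / 2 + K) ->
  forall j, (j <= n)%N -> a j <= a 0 + a n + n%:R ^+ 2 * K.
Proof.
move=> a0 K0 ha j jn.
pose b i := a i + i%:R ^+ 2 * K.
have bj : b j <= Num.max (b 0) (b n).
  apply: convex_seq_le_ends jn => i /ha.
  have -> : b i.+1 = a i.+1 + (i%:R + 1) ^+ 2 * K by rewrite /b -natr1.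
  have -> : b i.+2 = a i.+2 + (i%:R + 2) ^+ 2 * K.
    by rewrite /b -natr1 -natr1 -addrA -[1 + 1]/(2%:R).
  rewrite /b.
  have : i%:R ^+ 2 * K + (i%:R + 2) ^+ 2 * K = ((i%:R + 1) ^+ 2 * K) *+ 2 + K *+ 2.
    by ring.
  by move: (_ * K) (_ * K) (_ * K) => p q s *; lra.
have : a j <= b j by rewrite /b lerDl mulr_ge0// sqr_ge0.
move=> /le_trans -> //; apply: le_trans bj _.
have K1 : 0 <= n%:R ^+ 2 * K by rewrite mulr_ge0// sqr_ge0.
rewrite ge_max /b expr0n/= mul0r addr0; have := a0 0; have := a0 n.
by move=> *; apply/andP; split; lra.
Qed.

End discrete_convexity.

Section submean.
Variables (R : realType) (l : R) (F G : R -> R).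
Hypothesis l_gt0 : 0 < l.
Hypothesis F_ge0 : forall x, 0 <= F x.
Hypothesis DG : forall x, `|x| <= l -> is_derive x (1 : R) G (F x).
(* the conclusion of [pairing_submean] *)
Hypothesis F_submean : forall x z h, 0 <= h -> `|x| + h < l -> `|z| + h < l ->
  F x <= (F (x + h) + F (x - h)) / 2 + (F z + (F (z + h) + F (z - h)) / 2).

Lemma antiderivative_homo x y : - l <= x -> x <= y -> y <= l -> G x <= G y.
Proof.
move=> lx xy yl; apply: (@ger0_derive1_ndecr _ G (- l) l) => //.
- move=> z /(@subset_itv_oo_cc _ _ (- l) l).
  by rewrite /= in_itv/= -ler_norml => /DG[].
- move=> z /(@subset_itv_oo_cc _ _ (- l) l).
  by rewrite /= in_itv/= -ler_norml derive1E => /DG[_ ->].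
- apply: continuous_in_subspaceT => z /set_mem.
  by rewrite /= in_itv/= -ler_norml => /DG; exact: derive_continuous.
Qed.

(* There are at least three cells, so that the error can be controlled by the
   last three. *)
Variable n : nat.
Let N := n.+3.
Let h := 2 * l / N%:R.
Let p (j : nat) := - l + j%:R * h.
Let I (j : nat) := G (p j.+1) - G (p j).

Let h_gt0 : 0 < h.
Proof. by rewrite divr_gt0// mulr_gt0. Qed.

Let pN : p N = l.
Proof. by rewrite /p /h mulrC divfK ?pnatr_eq0//; ring. Qed.

Let pS j : p j.+1 = p j + h.
Proof. by rewrite /p mulrSr mulrDl mul1r addrA. Qed.

Let p_homo i j : (i <= j)%N -> p i <= p j.
Proof. by move=> ij; rewrite lerD2l ler_wpM2r ?(ltW h_gt0)// ler_nat. Qed.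

Let p_window j : (j <= N)%N -> - l <= p j <= l.
Proof.
move=> jN; rewrite -{2}pN p_homo// andbT.
by rewrite /p lerDl mulr_ge0// ltW.
Qed.

Let I_ge0 j : (j < N)%N -> 0 <= I j.
Proof.
move=> jN; rewrite subr_ge0.
have /andP[pl _] := p_window (ltnW jN); have /andP[_ lp] := p_window jN.
by apply: antiderivative_homo => //; exact: p_homo.
Qed.

(** The submean inequality integrated over a cell, with [z = x + k] in the last
    but one cell. In terms of the antiderivative: [M] is the difference of the
    two sides, and it increases. *)
Let I_submean j : (j.+2 < N)%N ->
  I j.+1 <= (I j + I j.+2) / 2 + (I n.+1 + (I n + I n.+2) / 2).
Proof.
move=> jN.
pose k : R := (n%:R - j%:R) * h.
have pk i : p (n + i)%N = p (j + i)%N + k.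
  by rewrite /p /k !natrD; ring.
pose M x := (G (x - h) + G (x + h)) / 2 +
  (G (x + k) + (G (x + k - h) + G (x + k + h)) / 2) - G x.
suff : M (p j.+1) <= M (p j.+2).
  rewrite /M /I.
  have -> : p n.+3 = p j.+3 + k by have := pk 3%N; rewrite !addn3.
  have -> : p n.+2 = p j.+2 + k by have := pk 2%N; rewrite !addn2.
  have -> : p n.+1 = p j.+1 + k by have := pk 1%N; rewrite !addn1.
  have -> : p n = p j + k by have := pk 0%N; rewrite !addn0.
  have -> : p j.+1 - h = p j by rewrite pS addrK.
  have -> : p j.+1 + h = p j.+2 by rewrite [RHS]pS.
  have -> : p j.+2 - h = p j.+1 by rewrite (pS j.+1) addrK.
  have -> : p j.+2 + h = p j.+3 by rewrite [RHS]pS.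
  have -> : p j.+1 + k - h = p j + k by rewrite (pS j); ring.
  have -> : p j.+1 + k + h = p j.+2 + k by rewrite (pS j.+1); ring.
  have -> : p j.+2 + k - h = p j.+1 + k by rewrite (pS j.+1); ring.
  have -> : p j.+2 + k + h = p j.+3 + k by rewrite (pS j.+2); ring.
  move: (G (p j)) (G (p j.+1)) (G (p j.+2)) (G (p j.+3)) (G (p j + k))
    (G (p j.+1 + k)) (G (p j.+2 + k)) (G (p j.+3 + k)) => *; lra.
have [pj0 pj3 pk0 pk3] : [/\ - l <= p j, p j + 3 * h <= l, - l <= p j + k
    & p j + k + 3 * h <= l].
  have S3 i : p i.+3 = p i + 3 * h by rewrite !pS; ring.
  have /andP[? _] := p_window (ltnW (ltnW (ltnW jN))).
  have /andP[_] := p_window jN; rewrite S3 => ?.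
  have := p_window (leqW (leqW (leqnSn n))).
  have := pk 0%N; rewrite !addn0 => <- /andP[? _]; split=> //.
  by rewrite -S3 -/N pN.
have win x : x \in `[p j.+1, p j.+2] ->
    [/\ `|x - h| <= l, `|x| <= l & `|x + h| <= l] /\
    [/\ `|x + k - h| <= l, `|x + k| <= l & `|x + k + h| <= l].
  rewrite in_itv/= !pS => /andP[px xp].
  have h0 := h_gt0.
  by rewrite !ler_norml; do !split; apply/andP; split; lra.
have DM x : x \in `[p j.+1, p j.+2] -> is_derive x (1 : R) M
   ((F (x - h) + F (x + h)) / 2 +
    (F (x + k) + (F (x + k - h) + F (x + k + h)) / 2) - F x).
  move=> /win[[xh1 xh2 xh3] [xk1 xk2 xk3]].
  have half (f g : R -> R) (df dg : R) :
      is_derive x (1 : R) f df -> is_derive x (1 : R) g dg ->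
      is_derive x (1 : R) (fun t => (f t + g t) / 2) ((df + dg) / 2).
    move=> Df Dg; have := derive_scale 2^-1 (derive_add Df Dg).
    by rewrite mulrC; under eq_fun do rewrite mulrC.
  have assoc (c c' : R) :
      (fun t => G (t + c + c')) = (fun t => G (t + (c + c'))).
    by apply/funext => t; rewrite addrA.
  have D2 (c c' : R) : `|x + c + c'| <= l ->
      is_derive x (1 : R) (fun t => G (t + c + c')) (F (x + c + c')).
    rewrite assoc -addrA => /DG D; exact: derive_translate D.
  apply: derive_sub; last exact: DG.
  apply: derive_add; first by apply: half; apply: derive_translate; exact: DG.
  apply: derive_add; first by apply: derive_translate; exact: DG.
  by apply: half; exact: D2.
have pj12 : p j.+1 <= p j.+2 by exact: p_homo.
apply: (@ger0_derive1_ndecr _ M (p j.+1) (p j.+2)) => //.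
- by move=> x /(@subset_itv_oo_cc _ _ (p j.+1) (p j.+2))/DM[].
- move=> x xp.
  have /DM[_] := @subset_itv_oo_cc _ _ (p j.+1) (p j.+2) x xp.
  rewrite derive1E => ->.
  rewrite subr_ge0 [F (x - h) + _]addrC [F (_ - h) + _]addrC.
  apply: F_submean; first exact: ltW.
  + rewrite -ltrBrDr ltr_norml; move: xp; rewrite in_itv/= !pS => /andP[px xp].
    by apply/andP; split; lra.
  + rewrite -ltrBrDr ltr_norml; move: xp; rewrite in_itv/= !pS => /andP[px xp].
    by apply/andP; split; lra.
- by apply: continuous_in_subspaceT => x /set_mem/DM; exact: derive_continuous.
Qed.

(** The masses of the cells form an almost convex sequence, each term of which is
    bounded by the first cell and the last three. *)
Lemma submean_mass_le :
  G l - G (- l) <= N%:R * (1 + N%:R ^+ 2) *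
    ((G (- l + h) - G (- l)) + (G l - G (l - 3 * h))).
Proof.
pose T := G l - G (l - 3 * h).
have h0 := h_gt0.
have p3 : l - 3 * h = p n.
  by apply/eqP; rewrite subr_eq; apply/eqP; rewrite -[LHS]pN /N !pS; ring.
have TE : T = I n + I n.+1 + I n.+2.
  by rewrite /T p3 -[X in G X - _]pN /I /N; ring.
have In j : (j <= n.+2)%N -> 0 <= I j by exact: I_ge0.
pose a j := if (j <= n.+2)%N then I j else 0.
have a0 j : 0 <= a j by rewrite /a; case: ifPn => // /In.
have := In _ (leqnSn n.+1); have := In _ (leqnn n.+2).
have := In _ (leqW (leqnSn n)) => I0 I2 I1.
have T0 : 0 <= T by rewrite TE; lra.
have Ia j : (j <= n.+2)%N -> I j = a j by rewrite /a => ->.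
have cvx j : (j.+2 <= n.+2)%N -> a j.+1 <= (a j + a j.+2) / 2 + T.
  move=> jn; have jn1 := ltnW jn; have jn0 := ltnW jn1; rewrite -!Ia//.
  by have := I_submean jn; rewrite TE => *; lra.
have bound := almost_convex_seq_le_ends a0 T0 cvx.
have -> : G l - G (- l) = \sum_(0 <= j < N) I j.
  rewrite telescope_sumr// pN; congr (_ - G _).
  by rewrite /p mul0r addr0.
have -> : G (- l + h) - G (- l) = I 0%N.
  by rewrite /I pS /p mul0r addr0.
rewrite -/T big_mkord -mulrA mulr_natl -[X in _ *+ X]card_ord -sumr_const.
apply: ler_sum => j _; have jn : (j <= n.+2)%N by rewrite -ltnS.
rewrite Ia//; apply: le_trans (bound j jn) _; rewrite -!Ia//.
have I00 := In 0%N isT.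
have N1 : n.+2%:R ^+ 2 <= N%:R ^+ 2 :> R.
  by rewrite ler_sqr ?nnegrE ?ler0n// ler_nat.
have N0 : 0 <= N%:R ^+ 2 :> R by rewrite sqr_ge0.
have IT : I n.+2 <= T by rewrite TE; lra.
have H1 : n.+2%:R ^+ 2 * T <= N%:R ^+ 2 * T by rewrite ler_wpM2r.
have H2 : 0 <= N%:R ^+ 2 * I 0%N by rewrite mulr_ge0.
have -> : (1 + N%:R ^+ 2) * (I 0%N + T) =
    I 0%N + T + N%:R ^+ 2 * I 0%N + N%:R ^+ 2 * T by ring.
apply: (@le_trans _ _ (I 0%N + T + N%:R ^+ 2 * T)).
  by apply: lerD H1; rewrite lerD2l.
by rewrite lerD2r lerDl.
Qed.

End submean.

(** * Control of a solution in a rectangle from its ends *)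

Section strip.
Variable R : realType.
Notation mu := (@lebesgue_measure R).

(** The derivatives exist in the open rectangle only, and may be unbounded near
    its sides. Continuity on the whole plane saves one-sided statements; a
    function that is continuous on the closed rectangle has such an extension,
    for instance [in_frame] below. *)
Definition strip_solution (l r lam : R) (g : R -> R -> R) : Prop :=
  [/\ forall x y, continuous2_at g x y,
      forall x y, `|x| < l -> `|y| = r -> g x y = 0 &
      exists gx gxx gy gyy : R -> R -> R,
        forall x y, `|x| < l -> `|y| < r ->
        [/\ is_derive x (1 : R) (g ^~ y) (gx x y) /\
              is_derive x (1 : R) (gx ^~ y) (gxx x y),
            is_derive y (1 : R) (g x) (gy x y) /\
              is_derive y (1 : R) (gy x) (gyy x y),
            continuous2_at gx x y /\ continuous2_at gy x y,
            continuous2_at gxx x y /\ continuous2_at gyy x y &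
            gxx x y + gyy x y = - lam * g x y]].

Lemma primitive_exists (l : R) (F : R -> R) : 0 < l -> continuous F ->
  exists G : R -> R, forall x, `|x| <= l -> is_derive x (1 : R) G (F x).
Proof.
move=> l0 cF; exists (fun x => \int[mu]_(t in `[(- l - 1), x]) F t) => x.
rewrite ler_norml => /andP[lx xl].
have iF : mu.-integrable `[(- l - 1), (l + 1)] (EFin \o F).
  by apply: integrable_continuous_itv => t _; exact: cF.
have xu : x < l + 1 by lra.
have ax : - l - 1 < x by lra.
have [D DE] := continuous_FTC1_closed xu iF ax (cF x).
by apply: (DeriveDef D); rewrite -derive1E; exact: DE.
Qed.

(** [C] can be chosen before [lam] because the parallelogram law does not involve
    [lam]; it comes from the number of cells, of order [l / d]. *)
Lemma strip_control (l r d : R) : 0 < l -> 0 < r -> 0 < d -> d <= l ->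
  exists2 C, 0 <= C & forall lam g, strip_solution l r lam g ->
  \int[mu]_(x in `[(- l), l]) pairing r g x x <=
  C * (\int[mu]_(x in `[(- l), (- l + d)]) pairing r g x x +
       \int[mu]_(x in `[(l - d), l]) pairing r g x x).
Proof.
move=> l0 r0 d0 dl.
(* The last three cells must fit into the end of length [d]; then so does the
   first one. *)
pose n := Num.truncn (6 * l / d).
exists (n.+3%:R * (1 + n.+3%:R ^+ 2)).
  by rewrite mulr_ge0// addr_ge0// sqr_ge0.
move=> lam g [cg bdry [gx [gxx [gy [gyy H]]]]].
pose F x := pairing r g x x.
have cid : continuous (@id R) by move=> x; exact: cvg_id.
have cF : continuous F.
  by move=> x; exact: (@continuous_pairing R r g cg R id id x cid cid).
have [G DG] := primitive_exists l0 cF.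
have F_submean := @pairing_submean R l r lam r0 g gx gxx gy gyy cg
  (fun x y xl yr => let: And5 a b c d e := H x y xl yr in a)
  (fun x y xl yr => let: And5 a b c d e := H x y xl yr in b)
  (fun x y xl yr => let: And5 a b c d e := H x y xl yr in c)
  (fun x y xl yr => let: And5 a b c d e := H x y xl yr in d)
  (fun x y xl yr => let: And5 a b c d e := H x y xl yr in e) bdry.
have FTC a b : a < b -> - l <= a -> b <= l ->
    \int[mu]_(x in `[a, b]) F x = G b - G a.
  move=> ab la bl; apply: (@integral_FTC_continuous R F G a b ab) => x.
    by move=> _; exact: cF.
  rewrite in_itv/= => /andP[ax xb]; apply: DG.
  by rewrite ler_norml (le_trans la)// (le_trans xb).
rewrite !FTC//; try lra.
have F0 x : 0 <= F x by exact: pairing_ge0.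
have := submean_mass_le l0 F0 DG F_submean n.
set h := 2 * l / n.+3%:R.
have hd : 3 * h <= d.
  have := truncnS_gt (6 * l / d); rewrite -/n ltr_pdivrMr// => ln.
  have : n.+1%:R * d <= n.+3%:R * d.
    by apply: ler_wpM2r; [exact: ltW|rewrite ler_nat leqW].
  rewrite /h mulrA ler_pdivrMr// [d * _]mulrC.
  by move: (n.+3%:R * d) => u nu; lra.
move=> /le_trans; apply; apply: ler_wpM2l.
  by rewrite mulr_ge0// addr_ge0// sqr_ge0.
have h0 : 0 < h by rewrite divr_gt0// mulr_gt0.
have homo := antiderivative_homo F0 DG.
apply: lerD; first by rewrite lerD2r; apply: homo; lra.
by rewrite lerD2l lerN2; apply: homo; lra.
Qed.

End strip.

(** * Lebesgue integrals of the plane in a rotated frame *)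

Section affine.
Variable R : realType.
Notation mu := (@lebesgue_measure R).
Local Open Scope ereal_scope.

(** The image of the Lebesgue measure under [x |-> a x + b], times [|a|], has the
    right values on intervals, hence is the Lebesgue measure. *)
Lemma ge0_integral_affine (a b : R) (f : measurableTypeR R -> \bar R) :
  a != 0%R -> measurable_fun setT f -> (forall x, 0 <= f x) ->
  `|a|%:E * \int[mu]_x f (a * x + b)%R = \int[mu]_x f x.
Proof.
move=> a0 mf f0; pose phi (x : measurableTypeR R) : measurableTypeR R := (a * x + b)%R.
have mphi : measurable_fun setT phi.
  by apply: measurable_funD => //; apply: measurable_funM.
pose m1 : {measure set (measurableTypeR R) -> \bar R} := pushforward mu phi.
pose nu : {measure set (measurableTypeR R) -> \bar R} :=
  mscale (NngNum (normr_ge0 a)) (m1 mphi).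
have mu_nu A : measurable A -> mu A = nu A.
  apply: lebesgue_measure_unique => X /ocitvP[->|[[x y]/= xy ->]].
    by rewrite !measure0.
  pose p := ((x - b) / a)%R; pose q := ((y - b) / a)%R.
  have a_gt0 : (0 < `|a|)%R by rewrite normr_gt0.
  rewrite /nu/= /mscale/= /pushforward lebesgue_measure_itv/= lte_fin xy.
  have [ap|an|a00] := ltgtP 0%R a; last by rewrite a00 eqxx in a0.
    rewrite (_ : phi @^-1` _ = [set` `]p, q]]); last first.
      apply/seteqP; split => t /=; rewrite /p /q !in_itv/= ltr_pdivrMr//
        ler_pdivlMr//; by rewrite [(t * a)%R]mulrC ltrBlDr lerBrDr.
    rewrite [X in _ = _ * X](lebesgue_measure_itv `]p, q])/=.
    rewrite lte_fin /p /q ltr_pM2r ?invr_gt0// ltrD2r xy gtr0_norm//.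
    rewrite -!EFinB -EFinM; congr EFin; field.
    by rewrite gt_eqF.
  rewrite (_ : phi @^-1` _ = [set` `[q, p[]); last first.
    apply/seteqP; split => t /=; rewrite /p /q !in_itv/= ler_ndivrMr//
      ltr_ndivlMr//; by rewrite [(t * a)%R]mulrC ltrBlDr lerBrDr andbC.
  rewrite [X in _ = _ * X](lebesgue_measure_itv `[q, p[)/=.
  rewrite lte_fin /p /q ltr_nM2r ?invr_lt0// ltrD2r xy ltr0_norm//.
  rewrite -!EFinB -EFinM; congr EFin; field.
  by rewrite lt_eqF.
rewrite [RHS](@eq_measure_integral _ _ _ _ nu) ?ge0_integral_mscale//=.
  by rewrite ge0_integral_pushforward.
by move=> A mA _; exact: mu_nu.
Qed.

(** The point with coordinates [(s, t)]: inverse to [(coord1, coord2)]. *)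
Definition frame (c e : R * R) (s t : R) : R * R :=
  (c.1 + s * e.1 - t * e.2, c.2 + s * e.2 + t * e.1)%R.

Notation R2 := (measurableTypeR R * measurableTypeR R)%type.

Lemma ge0_integral_affineV (a b : R) (f : measurableTypeR R -> \bar R) :
  a != 0%R -> measurable_fun setT f -> (forall x, 0 <= f x) ->
  \int[mu]_x f (a * x + b)%R = (`|a|^-1)%:E * \int[mu]_x f x.
Proof.
move=> a0 mf f0; rewrite -(ge0_integral_affine b a0 mf f0) muleA -EFinM mulVf ?mul1e//.
by rewrite normr_eq0.
Qed.

Lemma measurable_comp2 (k : R2 -> \bar R) d (T : measurableType d)
    (u v : T -> measurableTypeR R) :
  measurable_fun setT k -> measurable_fun setT u -> measurable_fun setT v ->
  measurable_fun setT (fun w => k (u w, v w)).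
Proof.
by move=> mk mu mv; apply: measurableT_comp => //; exact: measurable_fun_pair.
Qed.

(** A rotation is a product of shears and dilations, so Tonelli's theorem and
    one-dimensional substitutions suffice. For fixed [t], [x = c.1 + s e.1 - t e.2]
    replaces [s] as a variable; then, for fixed [x], the second coordinate
    replaces [t], the Jacobians being [|e.1|^-1] and [|e.1|]. When [e.1 = 0], the
    frame merely exchanges the coordinates, up to signs. *)
Lemma ge0_integral_frame (c e : R * R) (k : R2 -> \bar R) :
  (e.1 ^+ 2 + e.2 ^+ 2 = 1)%R -> measurable_fun setT k -> (forall x, 0 <= k x) ->
  \int[mu \x mu]_x k x = \int[mu]_s \int[mu]_t k (frame c e s t).
Proof.
move=> e1 mk k0.
have m1 (p q : R) : measurable_fun setT
    (fun t : measurableTypeR R => p * t + q : measurableTypeR R)%R.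
  by apply: measurable_funD => //; apply: measurable_funM.
have mfst : measurable_fun setT (fun w : R2 => w.1 : measurableTypeR R).
  exact: measurable_fst.
have msnd : measurable_fun setT (fun w : R2 => w.2 : measurableTypeR R).
  exact: measurable_snd.
have m2 (p q b : R) : measurable_fun setT
    (fun w : R2 => p * w.1 + q * w.2 + b : measurableTypeR R)%R.
  by apply: measurable_funD => //; apply: measurable_funD => //; apply: measurable_funM.
have mk2 (p q b p' q' b' : R) : measurable_fun setT
    (fun w : R2 => k (p * w.1 + q * w.2 + b, p' * w.1 + q' * w.2 + b')%R).
  by apply: measurable_comp2.
have int1 (p q y : R) : p != 0%R ->
    \int[mu]_s k (p * s + q, y)%R = (`|p|^-1)%:E * \int[mu]_x k (x, y).
  move=> p0; apply: (@ge0_integral_affineV p q (fun x => k (x, y))) => //.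
  exact: measurableT_comp.
have int2 (p q x : R) : p != 0%R ->
    \int[mu]_s k (x, p * s + q)%R = (`|p|^-1)%:E * \int[mu]_y k (x, y).
  move=> p0; apply: (@ge0_integral_affineV p q (fun y => k (x, y))) => //.
  exact: measurableT_comp.
rewrite (fubini_tonelli1 k mk k0) /fubini_F.
have [e10|e10] := eqVneq e.1 0%R.
  have e22 : (e.2 ^+ 2 = 1)%R by rewrite -e1 e10 expr0n/= add0r.
  have e20 : (e.2 != 0)%R.
    by apply: contra_eq_neq e22 => ->; rewrite expr0n/= eq_sym oner_eq0.
  have ne2 : `|e.2|%R = 1%R by apply/eqP; rewrite -sqrp_eq1// -normrX e22 normr1.
  transitivity (\int[mu]_s \int[mu]_x k (x, e.2 * s + c.2)%R).
    rewrite -(@fubini_tonelli _ _ _ _ _ mu mu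
      (fun w : R2 => k (w.1, e.2 * w.2 + c.2)%R))//=.
      by apply: eq_integral => x _; rewrite int2// ne2 invr1 mul1e.
    apply: measurable_comp2 => //.
    exact: (measurableT_comp (m1 e.2 c.2) msnd).
  apply: eq_integral => s _.
  have := @int1 (- e.2)%R c.1 (e.2 * s + c.2)%R.
  rewrite oppr_eq0 normrN ne2 invr1 mul1e => /(_ e20) <-.
  by apply: eq_integral => t _; congr (k (_, _)); rewrite /frame e10; ring.
have ne10 : `|e.1|%R != 0%R by rewrite normr_eq0.
(* the integrand in the variables [x] and [t] *)
pose kt (w : R2) := k (w.1, e.1^-1 * w.2 + (c.2 + (w.1 - c.1) * (e.2 / e.1)))%R.
have mkt : measurable_fun setT kt.
  have -> : kt = fun w : R2 => k (w.1,
      (e.2 / e.1) * w.1 + e.1^-1 * w.2 + (c.2 - c.1 * (e.2 / e.1)))%R.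
    by apply/funext => w; rewrite /kt; congr (k (_, _)); ring.
  exact: measurable_comp2.
have mkf : measurable_fun setT (fun w : R2 => k (frame c e w.1 w.2)).
  have -> : (fun w : R2 => k (frame c e w.1 w.2)) = fun w : R2 =>
      k (e.1 * w.1 + (- e.2) * w.2 + c.1, e.2 * w.1 + e.1 * w.2 + c.2)%R.
    by apply/funext => w; congr (k (_, _)); ring.
  exact: mk2.
rewrite (@fubini_tonelli _ _ _ _ _ mu mu (fun w : R2 => k (frame c e w.1 w.2))
  mkf (fun w => k0 _))/=.
have inner t : \int[mu]_s k (frame c e s t) =
    (`|e.1|^-1)%:E * \int[mu]_x kt (x, t).
  have := @ge0_integral_affineV e.1 (c.1 - t * e.2)%R (fun x => kt (x, t)) e10.
  move=> <-; last 2 first.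
  - by apply: (measurable_comp2 (k := kt) (u := id) (v := cst t)).
  - by move=> x; exact: k0.
  apply: eq_integral => s _; congr (k (_, _)); rewrite /= ?/kt/=; first ring.
  have e2e : (e.2 ^+ 2 = 1 - e.1 ^+ 2)%R by rewrite -e1 addrC addKr.
  have -> : (c.2 + (e.1 * s + (c.1 - t * e.2) - c.1) * (e.2 / e.1) =
     c.2 + s * e.2 * (e.1 / e.1) - t * (e.2 ^+ 2) / e.1)%R by ring.
  rewrite divff// e2e; field.
  exact: e10.
transitivity (\int[mu]_t ((`|e.1|^-1)%:E * \int[mu]_x kt (x, t))); last first.
  by apply: eq_integral => t _; rewrite inner.
rewrite ge0_integralZl//; last 2 first.
- exact: (measurable_fun_fubini_tonelli_G (m1 := mu) kt mkt (fun w => k0 _)).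
- by move=> t _; apply: integral_ge0 => x _; exact: k0.
rewrite -(@fubini_tonelli _ _ _ _ _ mu mu kt mkt (fun w => k0 _)).
have inner2 x : \int[mu]_t kt (x, t) = `|e.1|%:E * \int[mu]_y k (x, y).
  have := @int2 (e.1^-1)%R (c.2 + (x - c.1) * (e.2 / e.1))%R x.
  by rewrite invr_eq0 normfV invrK => <-.
rewrite (eq_integral _ _ (fun x _ => inner2 x)).
rewrite ge0_integralZl//; last 2 first.
- exact: (measurable_fun_fubini_tonelli_F (m2 := mu) k mk k0).
- by move=> t _; apply: integral_ge0 => x _; exact: k0.
by rewrite muleA -EFinM mulVf// mul1e.
Qed.

End affine.

(** An open set is the union of the countably many open boxes with rational
    vertices that it contains. *)
Lemma open_measurable2 (R : realType) (U : set (R * R)) : open U ->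
  measurable (U : set (measurableTypeR R * measurableTypeR R)).
Proof.
move=> oU.
pose box (q : rat * rat * (rat * rat)) : set (R * R) :=
  [set` `]ratr q.1.1, ratr q.1.2[] `*` [set` `]ratr q.2.1, ratr q.2.2[].
pose F q := if `[< box q `<=` U >] then box q else set0.
have -> : U = \bigcup_q F q.
  apply/seteqP; split => [[x y] Uxy|z [q _]]; last first.
    by rewrite /F; case: asboolP => // qU /qU.
  have [e/= e0 eU] := (@nbhs_ballP _ _ _ _).1 (open_nbhs_nbhs (conj oU Uxy)).
  have dens (a : R) : exists p q : rat, (a - e < ratr p < a)%R /\ (a < ratr q < a + e)%R.
    have [p] := @rat_in_itvoo R (a - e) a ltac:(lra).
    rewrite in_itv/= => pa.
    have [q] := @rat_in_itvoo R a (a + e) ltac:(lra).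
    by rewrite in_itv/= => qa; exists p, q.
  have [p1 [q1 [/andP[? ?] /andP[? ?]]]] := dens x.
  have [p2 [q2 [/andP[? ?] /andP[? ?]]]] := dens y.
  exists ((p1, q1), (p2, q2)) => //; rewrite /F asboolT.
    by split; rewrite /= in_itv/=; apply/andP.
  move=> [x' y'] [] /=; rewrite !in_itv/= => /andP[? ?] /andP[? ?].
  by apply: eU; split; rewrite /= /ball/= ltr_distlC; apply/andP; split; lra.
apply: countable_bigcupT_measurable => [|q]; first exact: countableP.
rewrite /F; case: asboolP => // _.
by apply: measurableX; exact: measurable_itv.
Qed.

Lemma continuous_closed_measurable2 (R : realType) (D : set (R * R))
    (f : R * R -> R) :
  closed D -> {within D, continuous f} ->
  measurable_fun (D : set (measurableTypeR R * measurableTypeR R)) f.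
Proof.
move=> cD /continuousP cf.
have mD : measurable (D : set (measurableTypeR R * measurableTypeR R)).
  rewrite -[D]setCK; apply: measurableC; apply: open_measurable2.
  exact: closed_openC.
apply: (measurability _ (RGenOpens.measurableE R)).
move=> _ [_ [a [b ->] <-]].
have : open (from_subspace D f @^-1` [set` `]a, b[]).
  by apply: cf; exact: interval_open.
move=> /open_subspaceP[V oV VD]; rewrite setIC -VD.
by apply: measurableI => //; exact: open_measurable2.
Qed.

(** * The stadium in the frame of its rectangle *)

Section paths.
Variable R : realType.

Lemma continuous_comp_within (T X Y : topologicalType) (D : set X) (f : X -> Y)
    (phi : T -> X) t :
  {within D, continuous f} -> (\forall t' \near t, D (phi t')) ->
  {for t, continuous phi} -> {for t, continuous (f \o phi)}.
Proof.
move=> cf Dphi cphi B fB.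
have : within D (nbhs (phi t)) (f @^-1` B).
  by rewrite nbhs_subspace_in; [exact: (cf (phi t) B fB)|exact: nbhs_singleton Dphi].
move=> /cphi; rewrite /= => H.
by apply: filterS (filterI Dphi H) => t' [Dt' /=]; exact.
Qed.

(** Points of the closure of the stadium are recognised as ends of segments that
    run inside it. *)
Lemma closure_path (T : topologicalType) (S : set T) (gam : R -> T) :
  {for 0, continuous gam} -> (forall th, 0 < th < 1 -> S (gam th)) ->
  closure S (gam 0).
Proof.
move=> cg Sg B /cg /= B0.
have : \forall th \near (0 : R)^'+, B (gam th).
  exact: (@filterS _ (nbhs (0 : R)) _ _ _ (fun th Bth _ => Bth) B0).
move=> B0'; near (0 : R)^'+ => th; exists (gam th); split.
  apply: Sg; apply/andP; split; near: th; first exact: nbhs_right_gt.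
  exact: nbhs_right_lt.
by near: th.
Unshelve. all: by end_near. Qed.

(** Truncation to [- m, m], in a form whose continuity is plain. *)
Definition clamp (m s : R) := (`|s + m| - `|s - m|) / 2.

Lemma clamp_id m s : `|s| <= m -> clamp m s = s.
Proof.
rewrite ler_norml => /andP[ms sm]; rewrite /clamp.
have -> : `|s + m| = s + m by rewrite ger0_norm //; lra.
have -> : `|s - m| = m - s by rewrite ler0_norm ?opprB //; lra.
lra.
Qed.

Lemma clamp_le m s : 0 <= m -> `|clamp m s| <= m.
Proof.
move=> m0; rewrite /clamp ler_norml.
have [h1|h1] := ger0P (s + m); have [h2|h2] := ger0P (s - m);
  apply/andP; split; lra.
Qed.

Lemma continuous_clamp m : continuous (clamp m).
Proof.
move=> s; apply: (@continuous_mul _ _ (fun s => `|s + m| - `|s - m|) (cst 2^-1)).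
  apply: continuous_sub; apply: cvg_norm.
    by apply: cvgD; [exact: cvg_id|exact: cvg_cst].
  by apply: cvgB; [exact: cvg_id|exact: cvg_cst].
exact: cvg_cst.
Qed.

End paths.

Section frame_coordinates.
Variables (R : realType) (c e : R * R).
Hypothesis e_unit : e.1 ^+ 2 + e.2 ^+ 2 = 1.

Lemma coord1_frame s t : coord1 c e (frame c e s t) = s.
Proof. by rewrite -[RHS]mulr1 -e_unit /coord1 /frame /=; ring. Qed.

Lemma coord2_frame s t : coord2 c e (frame c e s t) = t.
Proof. by rewrite -[RHS]mulr1 -e_unit /coord2 /frame /=; ring. Qed.

Lemma frame_coord x : frame c e (coord1 c e x) (coord2 c e x) = x.
Proof.
case: x => x1 x2; rewrite /frame /coord1 /coord2 /=; congr (_, _).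
  by transitivity (c.1 + (x1 - c.1) * (e.1 ^+ 2 + e.2 ^+ 2)); [ring|rewrite e_unit; ring].
by transitivity (c.2 + (x2 - c.2) * (e.1 ^+ 2 + e.2 ^+ 2)); [ring|rewrite e_unit; ring].
Qed.

Lemma continuous_frame (T : topologicalType) (s t : T -> R) z :
  {for z, continuous s} -> {for z, continuous t} ->
  {for z, continuous (fun z => frame c e (s z) (t z))}.
Proof.
move=> cs ct.
have c1 : {for z, continuous (fun z => c.1 + s z * e.1 - t z * e.2)}.
  by continuity.
have c2 : {for z, continuous (fun z => c.2 + s z * e.2 + t z * e.1)}.
  by continuity.
exact: (cvg_pair c1 c2).
Qed.

Lemma continuous_coord1 : continuous (coord1 c e).
Proof.
move=> x; have : {for x, continuous (fun x : R * R =>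
    (x.1 - c.1) * e.1 + (x.2 - c.2) * e.2)} by continuity.
by [].
Qed.

Lemma continuous_coord2 : continuous (coord2 c e).
Proof.
move=> x; have : {for x, continuous (fun x : R * R =>
    (x.2 - c.2) * e.1 - (x.1 - c.1) * e.2)} by continuity.
by [].
Qed.

End frame_coordinates.

Section derivatives.
Variable R : realType.
Implicit Types (f : R * R -> R) (v x : R * R).

(** The hypothesis on [phi] says that it is a line with direction [v]. *)
Lemma is_derive_line f (phi : R -> R * R) v t :
  (forall h, phi (h + t) = h *: v + phi t) -> differentiable f (phi t) ->
  is_derive t (1 : R) (f \o phi) ('D_v f (phi t)).
Proof.
move=> phiE df.
have E : (fun h : R =>
      h^-1 *: (((f \o phi) \o shift t) (h *: (1 : R)) - (f \o phi) t)) =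
    (fun h => h^-1 *: ((f \o shift (phi t)) (h *: v) - f (phi t))).
  apply/funext => h /=; congr (_ *: (f _ - _)).
  by rewrite phiE /= [h *: 1]mulr1.
have dfv : derivable f (phi t) v by exact: diff_derivable.
apply: DeriveDef; first by rewrite /derivable E.
by rewrite /derive E.
Qed.

Lemma derive_lin f x v : differentiable f x ->
  'D_v f x = v.1 * 'D_(1, 0) f x + v.2 * 'D_(0, 1) f x.
Proof.
move=> df; rewrite !deriveE//.
have {1}-> : v = v.1 *: (1, 0) + v.2 *: (0, 1).
  case: v => v1 v2 /=; congr (_, _); rewrite /=.
    by rewrite [v1 *: _]mulr1 [v2 *: _]mulr0 addr0.
  by rewrite [v1 *: _]mulr0 [v2 *: _]mulr1 add0r.
by rewrite linearD !linearZ.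
Qed.

(** The Laplacian is invariant under rotations; the mixed second derivatives
    cancel, whatever their symmetry. *)
Lemma laplacian_frame (M : set (R * R)) f x (e : R * R) :
  C2_on M f -> nbhs x M -> e.1 ^+ 2 + e.2 ^+ 2 = 1 ->
  'D_e ('D_e f) x + 'D_(- e.2, e.1) ('D_(- e.2, e.1) f) x = laplacian f x.
Proof.
move=> C2 Mx e1.
have Mxx := nbhs_singleton Mx.
have [dfx d2] := C2 x Mxx.
have d1 := (d2 (1, 0)).1; have d01 := (d2 (0, 1)).1.
have second v : 'D_v ('D_v f) x =
    v.1 * (v.1 * 'D_(1, 0) ('D_(1, 0) f) x + v.2 * 'D_(0, 1) ('D_(1, 0) f) x) +
    v.2 * (v.1 * 'D_(1, 0) ('D_(0, 1) f) x + v.2 * 'D_(0, 1) ('D_(0, 1) f) x).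
  have E1 : 'D_v ('D_v f) x =
      'D_v (fun y => v.1 *: 'D_(1, 0) f y + v.2 *: 'D_(0, 1) f y) x.
    apply: near_eq_derive; apply: filterS Mx => y /C2[dfy _].
    exact: derive_lin.
  have d10v := derivableP (diff_derivable (v := v) d1).
  have d01v := derivableP (diff_derivable (v := v) d01).
  have D := is_deriveD (is_deriveZ v.1 d10v) (is_deriveZ v.2 d01v).
  apply: (etrans E1); apply: (etrans (@derive_val _ _ _ _ _ _ _ D)).
  exact: (congr2 (fun a b => v.1 * a + v.2 * b)
    (derive_lin v d1) (derive_lin v d01)).
have rot (a b p q p' q' : R) : a ^+ 2 + b ^+ 2 = 1 ->
    a * (a * p + b * q) + b * (a * p' + b * q') +
    (- b * (- b * p + a * q) + a * (- b * p' + a * q')) = p + q'.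
  by move=> ab; rewrite -[RHS]mul1r -ab; ring.
exact: (etrans (congr2 +%R (second e) (second (- e.2, e.1)))
  (rot _ _ _ _ _ _ e1)).
Qed.

End derivatives.

Section stadium.
Variables (R : realType) (c e : R * R) (l r : R).
Hypotheses (e_unit : e.1 ^+ 2 + e.2 ^+ 2 = 1) (l_gt0 : 0 < l) (r_gt0 : 0 < r).
Let M := stadium c e l r.
Let fr := frame c e.

Lemma stadium_frame s t : M (fr s t) <->
  [\/ `|s| <= l /\ `|t| < r, l < s /\ (s - l) ^+ 2 + t ^+ 2 < r ^+ 2 |
      l < - s /\ (- s - l) ^+ 2 + t ^+ 2 < r ^+ 2].
Proof.
have c1N x : coord1 c (- e) x = - coord1 c e x.
  by rewrite /coord1 /=; ring.
have c2N x : coord2 c (- e) x = - coord2 c e x.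
  by rewrite /coord2 /=; ring.
rewrite /M /stadium /rectangle /half_disc /setU /= !c1N !c2N /fr.
rewrite coord1_frame// coord2_frame// sqrrN.
split=> [[?|[?|?]]|[?|?|?]].
- by apply: Or31.
- by apply: Or32.
- by apply: Or33.
- by left.
- by right; left.
- by right; right.
Qed.

Lemma closure_stadium_frame s t : `|s| <= l -> `|t| <= r -> closure M (fr s t).
Proof.
move=> sl tr.
pose gam (th : R) := fr ((1 - th) * s) ((1 - th) * t).
have -> : fr s t = gam 0 by rewrite /gam subr0 !mul1r.
apply: closure_path => [|th /andP[th0 th1]].
  apply: continuous_frame; by continuity.
apply/stadium_frame/Or31; rewrite !normrM ger0_norm; last lra.
have th1' : 0 <= 1 - th by lra.
split; first by apply: le_trans sl; rewrite ler_piMl//; lra.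
apply: (@le_lt_trans _ _ ((1 - th) * r)); first exact: ler_wpM2l.
by rewrite gtr_pMl//; lra.
Qed.

Lemma boundary_stadium_frame s t : `|s| < l -> `|t| = r -> boundary M (fr s t).
Proof.
move=> sl tr; split; first by apply: closure_stadium_frame; [exact: ltW|rewrite tr].
move=> /interior_subset /stadium_frame.
move: sl; rewrite ltr_norml => /andP[ls sl].
by case=> [[_]|[h _]|[h _]]; [rewrite tr ltxx| |]; lra.
Qed.

Lemma nbhs_stadium_frame s t : `|s| < l -> `|t| < r -> nbhs (fr s t) M.
Proof.
move=> sl tr.
have c1 : \forall x \near fr s t, `|coord1 c e x| < l.
  have cc : `|coord1 c e x| @[x --> fr s t] --> `|coord1 c e (fr s t)|.
    by apply: cvg_norm; exact: continuous_coord1.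
  by apply: (@cvgr_lt _ _ _ (nbhs_filter _) _ _ cc); rewrite coord1_frame.
have c2 : \forall x \near fr s t, `|coord2 c e x| < r.
  have cc : `|coord2 c e x| @[x --> fr s t] --> `|coord2 c e (fr s t)|.
    by apply: cvg_norm; exact: continuous_coord2.
  by apply: (@cvgr_lt _ _ _ (nbhs_filter _) _ _ cc); rewrite coord2_frame.
apply: filterS (filterI c1 c2) => x [x1 x2].
by left; split => //; exact: ltW.
Qed.

(** Values of a function in the frame of the rectangle; the truncations make it
    a continuous function of the whole plane. *)
Definition in_frame (f : R * R -> R) (s t : R) : R :=
  f (fr (clamp l s) (clamp r t)).

Lemma in_frame_id f s t : `|s| <= l -> `|t| <= r -> in_frame f s t = f (fr s t).
Proof. by move=> sl tr; rewrite /in_frame !clamp_id. Qed.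

Lemma continuous_in_frame f s t : {within closure M, continuous f} ->
  continuous2_at (in_frame f) s t.
Proof.
move=> cf.
have cc m (p : R * R -> R) z : {for z, continuous p} ->
    {for z, continuous (fun z => clamp m (p z))}.
  by move=> cp; apply: continuous_comp cp _; exact: continuous_clamp.
have cphi : {for (s, t), continuous (fun z : R * R =>
    fr (clamp l z.1) (clamp r z.2))}.
  by apply: continuous_frame; apply: cc; [exact: cvg_fst|exact: cvg_snd].
have Dphi : \forall z \near (s, t),
    closure M (fr (clamp l z.1) (clamp r z.2)).
  by apply: filterE => z; apply: closure_stadium_frame; apply: clamp_le; exact: ltW.
pose phi (z : R * R) := fr (clamp l z.1) (clamp r z.2).
have H := @continuous_comp_within (R * R)%type (R * R)%type R (closure M) f phi.
exact: (H (s, t) cf Dphi cphi).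
Qed.

Lemma strip_solution_eigen lam f :
  C2_on M f -> {within closure M, continuous f} ->
  (forall x, M x -> laplacian f x = - lam * f x) ->
  (forall x, boundary M x -> f x = 0) ->
  strip_solution l r lam (in_frame f).
Proof.
move=> C2 cf eqf f0.
pose e' := (- e.2, e.1).
have frE s t h : fr (h + s) t = h *: e + fr s t.
  by rewrite /fr /frame; congr (_, _); rewrite /= /GRing.scale/=; ring.
have frE' s t h : fr s (h + t) = h *: e' + fr s t.
  by rewrite /fr /frame; congr (_, _); rewrite /= /GRing.scale/=; ring.
have near_lt (s m : R) : `|s| < m -> \forall s' \near s, `|s'| <= m.
  by move=> /near_norm_lt; apply: filterS => s' /ltW.
have cont2 (h : R * R -> R) s t : {for fr s t, continuous h} ->
    continuous2_at (fun s t => h (fr s t)) s t.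
  move=> ch.
  have cfr : {for (s, t), continuous (fun z : R * R => fr z.1 z.2)}.
    by apply: continuous_frame; [exact: cvg_fst|exact: cvg_snd].
  exact: (continuous_comp cfr ch).
split.
- by move=> s t; exact: continuous_in_frame.
- move=> s t sl tr; rewrite in_frame_id; [|exact: ltW|by rewrite tr].
  by apply: f0; exact: boundary_stadium_frame.
exists (fun s t => 'D_e f (fr s t)), (fun s t => 'D_e ('D_e f) (fr s t)),
  (fun s t => 'D_e' f (fr s t)), (fun s t => 'D_e' ('D_e' f) (fr s t)) => s t sl tr.
have nM := nbhs_stadium_frame sl tr.
have MM := nbhs_singleton nM.
have [df d2] := C2 _ MM.
split.
- split.
    apply: near_eq_is_derive (is_derive_line (phi := fr ^~ t) (frE s t) df).
    apply: filterS (near_lt _ _ sl) => s' s'l.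
    by rewrite in_frame_id// ltW.
  exact: (is_derive_line (phi := fr ^~ t) (frE s t) (d2 e).1).
- split.
    apply: near_eq_is_derive (is_derive_line (phi := fr s) (frE' s t) df).
    apply: filterS (near_lt _ _ tr) => t' t'r.
    by rewrite in_frame_id// ltW.
  exact: (is_derive_line (phi := fr s) (frE' s t) (d2 e').1).
- by split; [have [d _] := d2 e|have [d _] := d2 e'];
    exact: (cont2 _ _ _ (differentiable_continuous d)).
- by split; [have [_ d] := d2 e; have := d e|have [_ d] := d2 e'; have := d e'];
    exact: cont2.
- by rewrite (laplacian_frame C2 nM e_unit) eqf// in_frame_id// ltW.
Qed.

End stadium.

(** * The damping near the half-discs *)

Section damping.
Variables (R : realType) (c e : R * R) (l r : R).
Hypotheses (e_unit : e.1 ^+ 2 + e.2 ^+ 2 = 1) (l_gt0 : 0 < l) (r_gt0 : 0 < r).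
Let M := stadium c e l r.
Let fr := frame c e.
Variable a : R * R -> R[i].
Hypothesis a_cont : continuous_onC (closure M) a.
Hypothesis a_eq1 : forall x, (M `\` rectangle c e l r) x -> a x = 1.

Lemma normc_sqr (z : R[i]) :
  Normc.normc z ^+ 2 = complex.Re z ^+ 2 + complex.Im z ^+ 2.
Proof. by case: z => x y /=; rewrite sqr_sqrtr// addr_ge0// sqr_ge0. Qed.

Lemma eq1_beyond s t : l < `|s| -> M (fr s t) -> a (fr s t) = 1.
Proof.
move=> ls Ms; apply: a_eq1; split=> // -[].
by rewrite coord1_frame// leNgt ls.
Qed.

(** The sides of the rectangle are limits of points of the half-discs: for
    [s = l] and [0 < th < 1], the point [(l + th r / 2, (1 - th) t)] is at
    distance less than [r] from [(l, 0)]. With [|th|] instead of [th] this is a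
    path through the closure of the stadium on both sides of [th = 0]. *)
Lemma re_eq1_side s t : `|s| = l -> `|t| <= r ->
  in_frame c e l r (re_part a) s t = 1.
Proof.
move=> sl tr; rewrite in_frame_id ?sl// -/fr.
pose gam (th : R) := fr (s + `|th| * (r / 2 / l * s)) ((1 - `|th|) * t).
have g0 : gam 0 = fr s t by rewrite /gam normr0 mul0r addr0 subr0 mul1r.
have cabs : {for 0, continuous (fun th : R => `|th|)} by exact: norm_continuous.
have cgam : {for 0, continuous gam}.
  by apply: continuous_frame; continuity_with ltac:(exact: cabs).
have Mgam th : 0 < `|th| < 1 -> l < `|s + `|th| * (r / 2 / l * s)| /\ M (gam th).
  move=> /andP[th0 th1].
  have q0 : 0 < `|th| * (r / 2) by rewrite mulr_gt0// divr_gt0.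
  have E : s + `|th| * (r / 2 / l * s) = s * (1 + `|th| * (r / 2) / l).
    by field; rewrite gt_eqF.
  have NE : `|s + `|th| * (r / 2 / l * s)| = l + `|th| * (r / 2).
    rewrite E normrM sl ger0_norm; last by rewrite addr_ge0// ltW// divr_gt0.
    by field; rewrite gt_eqF.
  have disc : (`|th| * (r / 2)) ^+ 2 + ((1 - `|th|) * t) ^+ 2 < r ^+ 2.
    have t2 : t ^+ 2 <= r ^+ 2.
      by rewrite -ler_sqrt ?sqr_ge0 ?exprn_gt0// !sqrtr_sqr (gtr0_norm r_gt0).
    have : ((1 - `|th|) * t) ^+ 2 <= (1 - `|th|) ^+ 2 * r ^+ 2.
      by rewrite exprMn ler_wpM2l ?sqr_ge0.
    move=> /(lerD (lexx ((`|th| * (r / 2)) ^+ 2)))/le_lt_trans; apply.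
    have -> : (`|th| * (r / 2)) ^+ 2 + (1 - `|th|) ^+ 2 * r ^+ 2 =
      r ^+ 2 - r ^+ 2 * (`|th| * (2 - `|th| * (5 / 4))) by field.
    rewrite ltrBlDr ltrDl mulr_gt0 ?exprn_gt0// mulr_gt0//; lra.
  split; first by rewrite NE ltrDl.
  apply/stadium_frame => //.
  have k0 : 0 <= 1 + `|th| * (r / 2) / l by rewrite addr_ge0// ltW// divr_gt0.
  have lq : l < l + `|th| * (r / 2) by rewrite ltrDl.
  have [s0|s0] := leP 0 s.
    have SE : s + `|th| * (r / 2 / l * s) = l + `|th| * (r / 2).
      have S0 : 0 <= s + `|th| * (r / 2 / l * s) by rewrite E mulr_ge0.
      by rewrite -NE (ger0_norm S0).
    by apply: Or32; rewrite SE addrAC subrr add0r.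
  have SE : - (s + `|th| * (r / 2 / l * s)) = l + `|th| * (r / 2).
    have S0 : s + `|th| * (r / 2 / l * s) <= 0 by rewrite E mulr_le0_ge0// ltW.
    by rewrite -NE (ler0_norm S0).
  by apply: Or33; rewrite SE addrAC subrr add0r.
have Dgam : \forall th \near 0, closure M (gam th).
  near=> th; have [->|th0] := eqVneq th 0.
    by rewrite g0; apply: closure_stadium_frame => //; rewrite sl.
  apply: subset_closure; apply: (Mgam th _).2; rewrite normr_gt0 th0/=.
  by near: th; apply: near_norm_lt; rewrite normr0.
have cag := @continuous_comp_within _ _ _ _ (re_part a) gam 0 a_cont.1 Dgam cgam.
have lim1 : re_part a (gam th) @[th --> (0 : R)^'+] --> re_part a (gam 0).
  exact: cvg_at_right_filter cag.
have lim2 : re_part a (gam th) @[th --> (0 : R)^'+] --> (1 : R).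
  apply: cvg_near_cst; near=> th.
  have th01 : 0 < `|th| < 1.
    have th0 : 0 < th by near: th; exact: nbhs_right_gt.
    rewrite (gtr0_norm th0) th0/=; near: th; exact: nbhs_right_lt.
  have [ls Mg] := Mgam th th01.
  by rewrite /re_part (eq1_beyond ls Mg).
by rewrite -g0; exact: (cvg_unique _ lim1 lim2).
Unshelve. all: by end_near. Qed.

(** [|a| >= 1/2] on the half-discs and near the sides that carry them: by the tube
    lemma, since these sides are compact. *)
Lemma damping_lower_bound : exists d, [/\ 0 < d, d <= l &
  forall s t, l - d <= `|s| -> M (fr s t) ->
    1 <= 4 * Normc.normc (a (fr s t)) ^+ 2].
Proof.
pose ga := in_frame c e l r (re_part a).
have cga s t : continuous2_at ga s t.
  by apply: continuous_in_frame => //; exact: a_cont.1.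
have near_side s0 : `|s0| = l -> \forall s \near s0,
    {in `[(- r), r], forall t, 1 / 2 < ga s t}.
  move=> s0l; have h0 : (0 : R) < 1 / 2 by lra.
  have := @near_itv_uniform R R ga s0 (- r) r _ h0 (fun t _ => cga s0 t).
  apply: filterS => s H t tr; have := H t tr.
  rewrite /ga re_eq1_side//; last by move: tr; rewrite in_itv/= ler_norml.
  by rewrite ltr_distlC => /andP[]; lra.
have [d1/= d10 H1] := near_side l (gtr0_norm l_gt0).
have [d2/= d20 H2] : \forall s \near - l, {in `[(- r), r], forall t, 1 / 2 < ga s t}.
  by apply: near_side; rewrite normrN gtr0_norm.
pose d := Num.min l (Num.min (d1 / 2) (d2 / 2)).
have d0 : 0 < d by rewrite !lt_min l_gt0 !divr_gt0.
exists d; split=> //; first by rewrite ge_min lexx.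
have dd1 : d < d1 by rewrite !gt_min; apply/orP; right; apply/orP; left; lra.
have dd2 : d < d2 by rewrite !gt_min; apply/orP; right; apply/orP; right; lra.
move=> s t ls Ms.
have [sl|sl] := ltP l `|s|.
  rewrite eq1_beyond// Normc.normc1 expr1n mulr1.
  by rewrite ler1n.
have tr : `|t| < r.
  have [[]//|[+ _]|[+ _]] := (stadium_frame c l r e_unit s t).1 Ms; move: sl.
  - by move=> /(le_trans (ler_norm _)) sl ls'; lra.
  - by rewrite -normrN => /(le_trans (ler_norm _)) sl ls'; lra.
have tr' : t \in `[(- r), r] by rewrite in_itv/= -ler_norml ltW.
have ga2 : 1 / 2 < ga s t.
  have [s0|s0] := leP 0 s.
    move: ls sl; rewrite (ger0_norm s0) => ls sl; apply: H1 tr' => /=.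
    by rewrite ger0_norm; lra.
  move: ls sl; rewrite (ltr0_norm s0) => ls sl; apply: H2 tr' => /=.
  by rewrite ler0_norm; lra.
move: ga2; rewrite /ga in_frame_id//; last exact: ltW.
rewrite normc_sqr /re_part -/fr => h.
have := sqr_ge0 (complex.Im (a (fr s t))).
by move: (complex.Im _ ^+ 2) => q q0; nra.
Qed.

End damping.

(** * Mass in strips *)

Section mass.
Variables (R : realType) (c e : R * R) (l r : R).
Hypotheses (e_unit : e.1 ^+ 2 + e.2 ^+ 2 = 1) (l_gt0 : 0 < l) (r_gt0 : 0 < r).
Notation mu := (@lebesgue_measure R).
Notation R2 := (measurableTypeR R * measurableTypeR R)%type.
Let M := stadium c e l r.
Let fr := frame c e.

Lemma measurable_sublevel (q : R * R -> R) (k : R) : continuous q ->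
  measurable ([set x | q x < k] : set R2) /\
  measurable ([set x | q x <= k] : set R2).
Proof.
move=> cq; split.
  apply: open_measurable2; apply: (open_comp (f := q) (D := [set x | x < k])).
    by move=> x _; exact: cq.
  exact: open_lt.
have -> : [set x | q x <= k] = ~` [set x | k < q x].
  by apply/seteqP; split => x /=; rewrite leNgt => /negP.
apply: measurableC; apply: open_measurable2.
apply: (open_comp (f := q) (D := [set x | k < x])).
  by move=> x _; exact: cq.
exact: open_gt.
Qed.

Let cc1 := @continuous_coord1 R c e.
Let cc2 := @continuous_coord2 R c e.

Lemma continuous_abs (q : R * R -> R) : continuous q -> continuous (fun x => `|q x|).
Proof. by move=> cq x; apply: cvg_norm; exact: cq. Qed.

Lemma measurable_half_disc e' : measurable (half_disc c e' l r : set R2).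
Proof.
have ccoord1 := @continuous_coord1 R c e'.
have ccoord2 := @continuous_coord2 R c e'.
have -> : half_disc c e' l r = [set x | - coord1 c e' x < - l] `&`
    [set x | (coord1 c e' x - l) ^+ 2 + coord2 c e' x ^+ 2 < r ^+ 2].
  by apply/seteqP; split => x [] /=; rewrite ltrN2.
apply: measurableI.
  by apply: (measurable_sublevel _ _).1 => x; apply: cvgN; exact: ccoord1.
apply: (measurable_sublevel _ _).1 => x.
have cd : {for x, continuous (fun x => (coord1 c e' x - l) * (coord1 c e' x - l)
    + coord2 c e' x * coord2 c e' x)}.
  continuity_with ltac:(first [exact: ccoord1|exact: ccoord2]).
exact: cd.
Qed.

Lemma measurable_stadium : measurable (M : set R2).
Proof.
apply: measurableU.
  apply: measurableI.
    exact: (measurable_sublevel _ (continuous_abs cc1)).2.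
  exact: (measurable_sublevel _ (continuous_abs cc2)).1.
by apply: measurableU; exact: measurable_half_disc.
Qed.

Definition strip (p q : R) : set (R * R) :=
  [set x | p <= coord1 c e x <= q /\ `|coord2 c e x| < r].

Lemma measurable_strip p q : measurable (strip p q : set R2).
Proof.
have -> : strip p q = ([set x | - coord1 c e x <= - p] `&`
    [set x | coord1 c e x <= q]) `&` [set x | `|coord2 c e x| < r].
  apply/seteqP; split => x /=; rewrite lerN2; first by move=> [/andP[]].
  by move=> [[px xq] x2]; split => //; apply/andP.
apply: measurableI; last exact: (measurable_sublevel _ (continuous_abs cc2)).1.
apply: measurableI; last exact: (measurable_sublevel _ cc1).2.
by apply: (measurable_sublevel _ _).2 => x; apply: cvgN; exact: cc1.
Qed.

Lemma strip_sub p q : - l <= p -> q <= l -> strip p q `<=` M.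
Proof.
move=> lp ql x [/andP[px xq] x2]; left; split => //.
by rewrite ler_norml (le_trans lp px) (le_trans xq ql).
Qed.

Lemma measurable_stadium_fun (k : R * R -> R) :
  {within closure M, continuous k} -> measurable_fun (M : set R2) k.
Proof.
move=> ck; apply: (@measurable_funS _ _ _ _ (closure M : set R2)).
- rewrite -[X in measurable X]setCK; apply: measurableC.
  by apply: open_measurable2; apply: closed_openC; exact: closed_closure.
- exact: subset_closure.
- by apply: continuous_closed_measurable2 => //; exact: closed_closure.
Qed.

Lemma integral_continuous_itv (f : R -> R) p q : continuous f ->
  (\int[mu]_(x in `[p, q]) (f x)%:E = (\int[mu]_(x in `[p, q]) f x)%:E)%E.
Proof.
move=> cf; rewrite /Rintegral fineK//; apply: integrable_fin_num => //.
by apply: integrable_continuous_itv => x _; exact: cf.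
Qed.

(** Tonelli in the frame of the rectangle. The free sides, which do not belong to
    the strip, have measure zero. *)
Lemma strip_mass (k : R * R -> R) p q : {within closure M, continuous k} ->
  (forall x, 0 <= k x) -> - l <= p -> q <= l ->
  (\int[mu \x mu]_(x in strip p q) (k x)%:E =
   (\int[mu]_(s in `[p, q]) \int[mu]_(t in `[(- r), r]) in_frame c e l r k s t)%:E)%E.
Proof.
move=> ck k0 lp ql.
have ckf s t := @continuous_in_frame R c e l r e_unit l_gt0 r_gt0 k s t ck.
pose Phi s := \int[mu]_(t in `[(- r), r]) in_frame c e l r k s t.
have cPhi : continuous Phi.
  move=> s; apply: (continuous_integral (f := in_frame c e l r k)).
    by apply: filterE => s' t _; exact: continuous2_slice (ckf s' t).
  by move=> t _; exact: ckf.
rewrite -(integral_continuous_itv _ _ cPhi).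
have mk : measurable_fun (strip p q : set R2) (EFin \o k).
  apply/measurable_EFinP; apply: measurable_funS (measurable_stadium_fun ck).
    exact: measurable_stadium.
  exact: strip_sub.
rewrite integral_mkcond (ge0_integral_frame c e_unit); last 2 first.
- by apply/(measurable_restrictT _ _).1 => //; exact: measurable_strip.
- by apply: erestrict_ge0 => x _; rewrite lee_fin.
rewrite [RHS]integral_mkcond; apply: eq_integral => s _.
have restrE t : ((fun x => (k x)%:E) \_ (strip p q)) (fr s t) =
    if (p <= s <= q) && (`|t| < r) then (k (fr s t))%:E else 0%E.
  rewrite patchE; case: ifPn => [/set_mem|/negP]; rewrite /strip /= /fr.
    by rewrite coord1_frame// coord2_frame// => -[-> ->].
  move=> H; case: ifPn => // /andP[ps tr]; case: H; apply/mem_set => /=.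
  by rewrite coord1_frame// coord2_frame.
rewrite patchE mem_setE in_itv/=; case: ifPn => ps; last first.
  by apply: integral0_eq => t _; rewrite restrE (negbTE ps).
have sl : `|s| <= l.
  by move/andP : ps => [ps sq]; rewrite ler_norml (le_trans lp ps) (le_trans sq ql).
have cks : continuous (in_frame c e l r k s).
  by move=> t; exact: continuous2_slice (ckf s t).
rewrite -(integral_continuous_itv _ _ cks).
have mks D : measurable_fun D (EFin \o in_frame c e l r k s).
  apply: measurable_funTS; apply/measurable_EFinP.
  exact: continuous_measurable_fun.
rewrite -integral_itv_obnd_cbnd// -integral_itv_bndo_bndc//.
rewrite [RHS]integral_mkcond; apply: eq_integral => t _; rewrite restrE ps patchE.
rewrite mem_setE in_itv/= -ltr_norml; case: ifPn => // tr.
by rewrite in_frame_id// ltW.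
Qed.

End mass.

(** * Control of the eigenfunctions *)

Section control.
Variables (R : realType) (c e : R * R) (l r : R).
Hypotheses (e_unit : e.1 ^+ 2 + e.2 ^+ 2 = 1) (l_gt0 : 0 < l) (r_gt0 : 0 < r).
Notation mu := (@lebesgue_measure R).
Notation R2 := (measurableTypeR R * measurableTypeR R)%type.
Let M := stadium c e l r.

Lemma eigen_parts lambda u : dirichlet_eigenfunction M lambda u ->
  (forall x, M x -> laplacian (re_part u) x = - lambda * re_part u x) /\
  (forall x, M x -> laplacian (im_part u) x = - lambda * im_part u x).
Proof.
move=> [_ _ eq _ _]; split=> x /eq; rewrite /re_part /im_part /laplacianC;
  case: (u x) => v w /eqP; rewrite eq_complex /= => /andP[/eqP e1 /eqP e2].
  by rewrite -[LHS]opprK e1 mul0r subr0 mulNr.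
by rewrite -[LHS]opprK e2 mul0r addr0 mulNr.
Qed.

Lemma eigen_strip lambda u : dirichlet_eigenfunction M lambda u ->
  strip_solution l r lambda (in_frame c e l r (re_part u)) /\
  strip_solution l r lambda (in_frame c e l r (im_part u)).
Proof.
move=> Eu; have [e1 e2] := eigen_parts Eu; have [[d1 d2] [c1 c2] _ b0 _] := Eu.
have b1 x : boundary M x -> re_part u x = 0 by move=> /b0; rewrite /re_part => ->.
have b2 x : boundary M x -> im_part u x = 0 by move=> /b0; rewrite /im_part => ->.
split; first exact: (strip_solution_eigen e_unit l_gt0 r_gt0 d1 c1 e1 b1).
exact: (strip_solution_eigen e_unit l_gt0 r_gt0 d2 c2 e2 b2).
Qed.

Lemma eigen_strip_control d : 0 < d -> d <= l -> exists2 C : R, 0 <= C &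
  forall lambda u, dirichlet_eigenfunction M lambda u ->
  let K := fun x => (Normc.normc (u x) ^+ 2)%:E in
  (\int[mu \x mu]_(x in strip c e r (- l) l) K x <=
   C%:E * (\int[mu \x mu]_(x in strip c e r (- l) (- l + d)) K x +
           \int[mu \x mu]_(x in strip c e r (l - d) l) K x))%E.
Proof.
move=> d0 dl; have [C C0 HC] := strip_control l_gt0 r_gt0 d0 dl.
exists C => // lambda u Eu /=; have [S1 S2] := eigen_strip Eu.
have [_ [c1 c2] _ _ _] := Eu.
pose k x := re_part u x ^+ 2 + im_part u x ^+ 2.
have k0 x : 0 <= k x by rewrite addr_ge0// sqr_ge0.
have ck : {within closure M, continuous k}.
  by move=> x; apply: cvgD; apply: cvgM; first [exact: c1 | exact: c2].
have KE p q : (\int[mu \x mu]_(x in strip c e r p q) (Normc.normc (u x) ^+ 2)%:E =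
    \int[mu \x mu]_(x in strip c e r p q) (k x)%:E)%E.
  by apply: eq_integral => x _; rewrite normc_sqr.
pose F1 s := pairing r (in_frame c e l r (re_part u)) s s.
pose F2 s := pairing r (in_frame c e l r (im_part u)) s s.
have cF (g : R -> R -> R) : (forall x y, continuous2_at g x y) ->
    continuous (fun s => pairing r g s s).
  have cid : continuous (@id R) by move=> x; exact: cvg_id.
  by move=> cg x; exact: (@continuous_pairing R r g cg R id id x cid cid).
have [cg1 _ _] := S1; have [cg2 _ _] := S2.
have iF1 p q : mu.-integrable `[p, q] (EFin \o F1).
  by apply: integrable_continuous_itv => x _; exact: cF.
have iF2 p q : mu.-integrable `[p, q] (EFin \o F2).
  by apply: integrable_continuous_itv => x _; exact: cF.
have kE s : \int[mu]_(t in `[(- r), r]) in_frame c e l r k s t = F1 s + F2 s.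
  rewrite /F1 /F2 /pairing -RintegralD//.
  - exact: integrable_pairing.
  - exact: integrable_pairing.
have smass p q : - l <= p -> q <= l ->
    (\int[mu \x mu]_(x in strip c e r p q) (k x)%:E =
    (\int[mu]_(s in `[p, q]) F1 s + \int[mu]_(s in `[p, q]) F2 s)%:E)%E.
  move=> lp ql; rewrite (strip_mass e_unit l_gt0 r_gt0 ck k0 lp ql) -RintegralD//.
  congr (_%:E).
  by apply: eq_Rintegral => s _; exact: kE.
have l1 : - l + d <= l by lra.
have l2 : - l <= l - d by lra.
rewrite !KE (smass _ _ (lexx _) (lexx _)) (smass _ _ (lexx _) l1)
  (smass _ _ l2 (lexx _)).
rewrite -EFinD -EFinM lee_fin.
apply: le_trans (lerD (HC _ _ S1) (HC _ _ S2)) _.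
by rewrite -mulrDr addrACA.
Qed.

End control.

Theorem theorem3 (R : realType) (c e : R * R) (l r : R)
  (e_unit : e.1 ^+ 2 + e.2 ^+ 2 = 1) (l_gt0 : 0 < l) (r_gt0 : 0 < r)
  (a : R * R -> R[i])
  (a_cont : continuous_onC (closure (stadium c e l r)) a)
  (a_eq1 : forall x, (stadium c e l r `\` rectangle c e l r) x -> a x = 1) :
  exists2 C : R, 0 < C &
    forall (lambda : R) (u : R * R -> R[i]),
      dirichlet_eigenfunction (stadium c e l r) lambda u ->
      (C%:E * mass (stadium c e l r) (fun x => (a x * u x)%R)
         >= mass (stadium c e l r) u)%E.
Proof.
have [d [d0 dl ad]] := damping_lower_bound e_unit l_gt0 r_gt0 a_cont a_eq1.
have [C0 C00 HC0] := eigen_strip_control c e_unit l_gt0 r_gt0 d0 dl.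
(* [4] compares [|u|^2] and [|a u|^2] on [Z] below, where [|a| >= 1/2]; [C0]
   bounds the mass in the rectangle by two strips, each of which lies in [Z]. *)
exists (4 * (1 + C0 * 2)); first by rewrite mulr_gt0// ltr_wpDr// mulr_ge0.
move=> lambda u Eu.
set M := stadium c e l r.
pose mu2 := (@lebesgue_measure R \x @lebesgue_measure R)%E.
pose K x : \bar R := (Normc.normc (u x) ^+ 2)%:E.
pose A x : \bar R := (Normc.normc (a x * u x) ^+ 2)%:E.
have mM := measurable_stadium c e l r.
have [_ [c1 c2] _ _ _] := Eu.
have K0 x : (0 <= K x)%E by rewrite lee_fin sqr_ge0.
have A0 x : (0 <= A x)%E by rewrite lee_fin sqr_ge0.
have mn (v : R * R -> R[i]) : continuous_onC (closure M) v ->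
    measurable_fun (M : set (measurableTypeR R * measurableTypeR R))
      (fun x => Normc.normc (v x) ^+ 2).
  move=> [cv1 cv2]; under eq_fun do rewrite normc_sqr.
  by apply: measurable_funD; apply: measurable_funX; exact: measurable_stadium_fun.
have mK : measurable_fun (M : set (measurableTypeR R * measurableTypeR R)) K.
  by apply/measurable_EFinP; apply: mn.
have mA : measurable_fun (M : set (measurableTypeR R * measurableTypeR R)) A.
  apply/measurable_EFinP; under eq_fun do rewrite Normc.normcM exprMn.
  by apply: measurable_funM; exact: mn.
pose Z := M `&` [set x | l - d <= `|coord1 c e x|].
have mZ : measurable (Z : set (measurableTypeR R * measurableTypeR R)).
  apply: measurableI => //.
  have -> : [set x | l - d <= `|coord1 c e x|] =
      [set x | - `|coord1 c e x| <= - (l - d)].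
    by apply/seteqP; split => x /=; rewrite lerN2.
  apply: (measurable_sublevel _ _).2 => x; apply: cvgN; apply: continuous_abs.
  exact: continuous_coord1.
have ZM : Z `<=` M by move=> x [].
have sM p q := @strip_sub R c e l r p q.
have subK D D' : measurable (D : set (measurableTypeR R * measurableTypeR R)) ->
    measurable (D' : set (measurableTypeR R * measurableTypeR R)) ->
    D `<=` D' -> D' `<=` M ->
    (\int[mu2]_(x in D) K x <= \int[mu2]_(x in D') K x)%E.
  move=> mD mD' DD' D'M; apply: ge0_subset_integral => //.
  exact: measurable_funS mK.
have IZ :
    (\int[mu2]_(x in M) K x <= (1 + C0 * 2)%:E * \int[mu2]_(x in Z) K x)%E.
  have inner : M `\` Z `<=` strip c e r (- l) l.
    move=> x [Mx nZ].
    have x1 : `|coord1 c e x| < l - d.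
      by rewrite ltNge; apply/negP => x1; apply: nZ.
    have x1l : `|coord1 c e x| <= l by apply/ltW/(lt_le_trans x1); rewrite gerBl ltW.
    split; first by rewrite -ler_norml.
    move: Mx; rewrite -{1}(frame_coord c e_unit x) => /(stadium_frame c l r e_unit).
    move: x1l; rewrite ler_norml => /andP[lx xl].
    by case=> [[]//|[+ _]|[+ _]]; lra.
  have left_strip : strip c e r (- l) (- l + d) `<=` Z.
    move=> x sx; split; first by apply: sM sx; [exact: lexx|lra].
    move: sx => [/andP[_ x1] _] /=.
    by rewrite -normrN (le_trans _ (ler_norm _))//; lra.
  have right_strip : strip c e r (l - d) l `<=` Z.
    move=> x sx; split; first by apply: sM sx; [lra|exact: lexx].
    by move: sx => [/andP[x1 _] _] /=; rewrite (le_trans x1)// ler_norm.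
  have mstrip p q := measurable_strip c e r p q.
  have MZ : M = Z `|` (M `\` Z) by rewrite setDUK.
  rewrite {1}MZ ge0_integral_setU//; last 3 first.
  - exact: measurableD.
  - by rewrite -MZ.
  - by apply/disj_setPS => x [Zx [_ /(_ Zx)]].
  have dbl (x : \bar R) : ((1 + 1)%:E * x = x + x)%E.
    by rewrite EFinD ge0_muleDl ?lee_fin// mul1e.
  rewrite EFinD ge0_muleDl ?lee_fin ?mulr_ge0// mul1e; apply: leeD => //.
  apply: (@le_trans _ _ (\int[mu2]_(x in strip c e r (- l) l) K x)%E).
    by apply: subK => //; [exact: measurableD|apply: sM; exact: lexx].
  apply: le_trans (HC0 _ _ Eu) _; rewrite EFinM -muleA; apply: lee_wpmul2l => //.
  by rewrite dbl; apply: leeD; apply: subK.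
have ZA : (\int[mu2]_(x in Z) K x <= 4%:E * \int[mu2]_(x in M) A x)%E.
  have mAZ : measurable_fun (Z : set (measurableTypeR R * measurableTypeR R)) A.
    exact: measurable_funS mA.
  apply: (@le_trans _ _ (\int[mu2]_(x in Z) (4%:E * A x))%E).
    apply: ge0_le_integral => //.
    - exact: measurable_funS mK.
    - exact: measurable_funeM.
    move=> x [Mx x1].
    rewrite -EFinM lee_fin Normc.normcM exprMn mulrA ler_peMl ?sqr_ge0//.
    by have := ad (coord1 c e x) (coord2 c e x); rewrite frame_coord//; exact.
  rewrite ge0_integralZl//; apply: lee_wpmul2l => //.
  by apply: ge0_subset_integral.
apply: (le_trans IZ).
rewrite [(4 * _)%R]mulrC EFinM -muleA; apply: lee_wpmul2l => //.
by rewrite lee_fin addr_ge0// mulr_ge0.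
Qed.
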